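(* Let $f=f(x^1,x^3)$ be a smooth function of two variables with $f_3\neq0$, let $[g_{\mathcal D_f}]$ be Bryant's conformal structure represented by the metric $g_{\mathcal D_f}=2\theta^1\theta^4+2\theta^2\theta^5+2\theta^3\theta^6$, with Schouten tensor $P$, and let $$\tilde g_f=2\,d(\varrho t)\,dt+t^2\big(g_{\mathcal D_f}+2\varrho P\big)$$ be the ambient metric with $Q=0$. Then the holonomy of $\tilde g_f$ is contained in $\mathfrak{po}(3,2)$, and hence contained in $\mathfrak{spin}(4,3)$.
   Context: Coordinates on an open set of $\mathbb R^6$ near the origin are $(x^1,x^2,x^3,y^1,y^2,y^3)$, with additional coordinates $t>0$ and $\varrho$ near $0$; $f_i=\partial f/\partial x^i$ etc. For $f=f(x^1,x^3)$ the co-frame is $\theta^1=dy^1+x^2dx^3$, $\theta^2=dy^2+f\,dx^1$, $\theta^3=dy^3+x^1dx^2$, $\theta^4=\tfrac32f_3^2dx^1$, $\theta^5=\tfrac32f_3dx^2-\tfrac12f_{33}\theta^1$, $\theta^6=\tfrac32f_3^2dx^3+\tfrac12f_{13}\theta^2$. The Schouten tensor in dimension 6 is $P=\frac14\big(Ric-\frac{Scal}{10}g\big)$. The metrics $2\,d(\varrho t)dt+t^2(g_{\mathcal D_f}+2\varrho P+\varrho^3Q)$, with $Q$ a combination of $\theta^i\theta^j$, $i,j\in\{2,4,6\}$, with coefficients depending on $(x^1,x^3)$, are Ricci-flat ambient metrics for $[g_{\mathcal D_f}]$; here $Q=0$. Holonomy algebras are considered up to conjugation in $\mathfrak{so}(4,4)$,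 realised with respect to the bilinear form $\begin{pmatrix} 0 & I_4 \\ I_4 & 0 \end{pmatrix}$ on $\mathbb R^8$. The algebra $\mathfrak{po}(3,2)=\mathfrak{so}(3,2)\ltimes\mathbb R^{3,2}$ is represented in $\mathfrak{so}(4,4)$ as follows (this is not the stabilizer of a null vector). The matrices $\begin{pmatrix}X&Z\\ 0&-X^\top\end{pmatrix}$ with $X\in\mathfrak{sl}_4\mathbb R$, $Z$ skew, form $\mathfrak{sl}_4\mathbb R\ltimes\Lambda_4\mathbb R\simeq\mathfrak{so}(3,3)\ltimes\mathbb R^{3,3}=\mathfrak{po}(3,3)$, where the skew matrices $\Lambda_4\mathbb R\simeq\Lambda^2\mathbb R^4$ carry the $\mathfrak{sl}_4\mathbb R$-invariant signature $(3,3)$ form defined by $\sigma\wedge\xi=\langle\sigma,\xi\rangle e_1\wedge e_2\wedge e_3\wedge e_4$. For the nondegenerate skew matrix $J=\begin{pmatrix}0&0&0&-1\\ 0&0&-1&0\\ 0&1&0&0\\ 1&0&0&0\end{pmatrix}$, the subalgebra of those matrices with $XJ+JX^\top=0$ (i.e. $X\in\mathfrak{sp}_2\mathbb R\simeq\mathfrak{so}(3,2)$, the 10-dimensional symplectic algebra) and $Z\in(\mathbb R J)^\perp\simeq\mathbb R^{3,2}$ is $\mathfrak{po}(3,2)$. $\mathfrak{spin}(4,3)\subset\mathfrak{so}(4,4)$ is given by the real 8-dimensional spin representation. *)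

(* Defs.v *)
From HB Require Import structures.
From mathcomp Require Import all_boot all_order all_algebra.
From mathcomp Require Import all_classical all_reals all_analysis.
From mathcomp Require Import ring.

Set Implicit Arguments.
Unset Strict Implicit.
Unset Printing Implicit Defensive.

Import Order.TTheory GRing.Theory Num.Theory.
Import numFieldNormedType.Exports.

Local Open Scope classical_set_scope.
Local Open Scope ring_scope.

Definition pd {R : realType} {n : nat} (i : 'I_n) (F : 'rV[R]_n -> R)
  (p : 'rV[R]_n) : R := 'D_(delta_mx 0 i) F p.

(* C^oo on U: differentiability of every iterated partial derivative
   includes their continuity. *)
Definition smooth_on {R : realType} {n : nat} (U : set 'rV[R]_n)
  (F : 'rV[R]_n -> R) : Prop :=
  forall (l : seq 'I_n) (p : 'rV[R]_n), U p -> differentiable (foldr pd F l) p.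

(* A pseudo-Riemannian metric on a domain of R^n is given by its matrix in the
   standard coordinates. *)
Definition christoffel {R : realType} {n : nat} (g : 'rV[R]_n -> 'M[R]_n)
  (k i j : 'I_n) (p : 'rV[R]_n) : R :=
  2^-1 * \sum_(l < n) invmx (g p) k l *
    (pd i (fun q => g q j l) p + pd j (fun q => g q i l) p
     - pd l (fun q => g q i j) p).

Definition ricci {R : realType} {n : nat} (g : 'rV[R]_n -> 'M[R]_n)
  (p : 'rV[R]_n) : 'M[R]_n :=
  \matrix_(i, j) \sum_(k < n)
    (pd k (christoffel g k i j) p - pd j (christoffel g k i k) p
     + \sum_(l < n) (christoffel g k k l p * christoffel g l i j p
                     - christoffel g k j l p * christoffel g l i k p)).

Definition scalar_curvature {R : realType} {n : nat}
  (g : 'rV[R]_n -> 'M[R]_n) (p : 'rV[R]_n) : R :=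
  \sum_(i < n) \sum_(j < n) invmx (g p) i j * ricci g p i j.

Definition schouten6 {R : realType} (g : 'rV[R]_6 -> 'M[R]_6)
  (p : 'rV[R]_6) : 'M[R]_6 :=
  4^-1 *: (ricci g p - (scalar_curvature g p / 10) *: g p).

Definition smooth_curve {R : realType} {n : nat} (c : R -> 'rV[R]_n) : Prop :=
  forall (i : 'I_n) (m : nat) (s : R),
    derivable (derive1n m (fun u => c u 0 i)) s 1.

(* The columns of W are the Levi-Civita parallel vector fields along c on
   [0, 1] which start at the coordinate vectors; hence W 1 is the parallel
   transport from c 0 to c 1, acting on column vectors. *)
Definition parallel_frame {R : realType} {n : nat} (g : 'rV[R]_n -> 'M[R]_n)
  (c : R -> 'rV[R]_n) (W : R -> 'M[R]_n) : Prop :=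
  [/\ W 0 = 1%:M,
      forall k j : 'I_n, {within `[0, 1], continuous (fun u => W u k j)} &
      forall (k j : 'I_n) (s : R), 0 < s < 1 ->
        is_derive s 1 (fun u => W u k j)
          (- \sum_(a < n) \sum_(b < n)
               christoffel g k a b (c s) * derive1 (fun u => c u 0 a) s
               * W s b j)].

(* transport M g p q A: A is the parallel transport from p to q along some
   piecewise smooth curve in M, given as a finite concatenation of smooth
   curves parametrised by [0, 1]. *)
Inductive transport {R : realType} {n : nat} (M : set 'rV[R]_n)
  (g : 'rV[R]_n -> 'M[R]_n) (p : 'rV[R]_n) : 'rV[R]_n -> 'M[R]_n -> Prop :=
| transport_refl : transport M g p p 1%:M
| transport_step (q r : 'rV[R]_n) (A : 'M[R]_n) (c : R -> 'rV[R]_n)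
    (W : R -> 'M[R]_n) :
    transport M g p q A ->
    smooth_curve c -> (forall s : R, 0 <= s <= 1 -> M (c s)) ->
    c 0 = q -> c 1 = r -> parallel_frame g c W ->
    transport M g p r (W 1 *m A).

Definition holonomy_group {R : realType} {n : nat} (M : set 'rV[R]_n)
  (g : 'rV[R]_n -> 'M[R]_n) (p : 'rV[R]_n) : set 'M[R]_n :=
  [set A | transport M g p p A].

(* The Lie algebra of the holonomy group: the A such that exp (s A) lies in the
   group for all s, phi s being exp (s A). *)
Definition holonomy_algebra {R : realType} {n : nat} (M : set 'rV[R]_n)
  (g : 'rV[R]_n -> 'M[R]_n) (p : 'rV[R]_n) : set 'M[R]_n :=
  [set A | exists phi : R -> 'M[R]_n,
     [/\ forall s : R, holonomy_group M g p (phi s),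
         forall s t : R, phi (s + t) = phi s *m phi t &
         forall i j : 'I_n, is_derive (0 : R) 1 (fun s => phi s i j) (A i j)]].

Definition form44 {R : realType} : 'M[R]_(4 + 4) := block_mx 0 1%:M 1%:M 0.

Definition so44 {R : realType} : set 'M[R]_8 :=
  [set A | A^T *m form44 + form44 *m A = 0].

(* A subset h of so(T_p, gp) lies, up to conjugation, in a subset a of so(4,4):
   the columns of T form a basis of T_p in which gp becomes form44. *)
Definition contained_up_to_conj {R : realType} (gp : 'M[R]_8)
  (h a : set 'M[R]_8) : Prop :=
  exists T : 'M[R]_8, T^T *m gp *m T = form44 /\
    forall A : 'M[R]_8, h A -> a (invmx T *m A *m T).

Definition skew {R : realType} (Z : 'M[R]_4) : Prop := Z^T = - Z.

(* A skew matrix s stands for the bivector \sum_(i < j) s i j e_i /\ e_j;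
   this is the coefficient of e_1 /\ e_2 /\ e_3 /\ e_4 in s /\ x. *)
Definition wedge_form {R : realType} (s x : 'M[R]_4) : R :=
  s 0 1 * x 2 3 - s 0 2 * x 1 3
  + s 0 3 * x 1 2 + s 1 2 * x 0 3
  - s 1 3 * x 0 2 + s 2 3 * x 0 1.

Definition J4 {R : realType} : 'M[R]_4 :=
  \matrix_(i, j) if (i + j == 3)%N then (if (i < 2)%N then -1 else 1) else 0.

Definition po33_mx {R : realType} (X Z : 'M[R]_4) : 'M[R]_(4 + 4) :=
  block_mx X Z 0 (- X^T).

Definition po32 {R : realType} : set 'M[R]_8 :=
  [set A | exists X Z : 'M[R]_4,
     [/\ A = po33_mx X Z, \tr X = 0, skew Z,
         X *m J4 + J4 *m X^T = 0 & wedge_form Z J4 = 0]].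

(* Hodge dual: (hodge s) i j is the coefficient of s /\ e_i /\ e_j. *)
Definition hodge {R : realType} (s : 'M[R]_4) : 'M[R]_4 :=
  \matrix_(i, j) wedge_form s (delta_mx i j - delta_mx j i).

(* The action on R^8 of the vectors (a, s) of R + Lambda^2 R^4 = R^(4,3) under
   an irreducible module of the Clifford algebra Cl(4,3); lemma clifford_sqr
   gives the quadratic form and clifford_so44 the compatibility with form44. *)
Definition clifford {R : realType} (a : R) (s : 'M[R]_4) : 'M[R]_(4 + 4) :=
  block_mx a%:M s (hodge s) (- a%:M).

Lemma hodge_skew {R : realType} (s : 'M[R]_4) : skew (hodge s).
Proof. by apply/matrixP => i j; rewrite !mxE /wedge_form !mxE; ring. Qed.

Lemma hodge_mulr {R : realType} (s : 'M[R]_4) : skew s ->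
  s *m hodge s = (- (wedge_form s s / 2))%:M.
Proof.
move=> skew_s; have hs i j : s i j = - s j i.
  by have := congr1 (fun m : 'M[R]_4 => m j i) skew_s; rewrite !mxE.
have h0 i : s i i = 0.
  by apply/eqP; have /eqP := hs i i; rewrite -subr_eq0 opprK -mulr2n mulrn_eq0.
have e (i : 'I_4) : [\/ i = 0, i = 1, i = 2 | i = 3].
  case: i => -[|[|[|[|//]]]] ilt.
  - by apply: Or41; apply: val_inj.
  - by apply: Or42; apply: val_inj.
  - by apply: Or43; apply: val_inj.
  - by apply: Or44; apply: val_inj.
have l3 : lift ord0 (lift ord0 (lift ord0 (ord0 : 'I_1))) = 3 :> 'I_4.
  exact: val_inj.
have l2 : lift ord0 (lift ord0 (ord0 : 'I_2)) = 2 :> 'I_4 by exact: val_inj.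
have l1 : lift ord0 (ord0 : 'I_3) = 1 :> 'I_4 by exact: val_inj.
have l0 : ord0 = 0 :> 'I_4 by exact: val_inj.
apply/matrixP => i j.
rewrite !mxE !big_ord_recl big_ord0 l3 l2 l1 l0 !mxE /wedge_form !mxE.
case: (e i) => ->; case: (e j) => -> /=; rewrite ?h0 ?(hs 1 0) ?(hs 2 0)
  ?(hs 3 0) ?(hs 2 1) ?(hs 3 1) ?(hs 3 2) ?mulr1n ?mulr0n; by field.
Qed.

Lemma hodge_mull {R : realType} (s : 'M[R]_4) : skew s ->
  hodge s *m s = (- (wedge_form s s / 2))%:M.
Proof.
move=> skew_s; rewrite -tr_scalar_mx -hodge_mulr// trmx_mul skew_s.
by rewrite hodge_skew mulNmx mulmxN opprK.
Qed.

Lemma clifford_sqr {R : realType} (a : R) (s : 'M[R]_4) : skew s ->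
  clifford a s *m clifford a s = (a ^+ 2 - wedge_form s s / 2)%:M.
Proof.
move=> skew_s; rewrite /clifford mulmx_block hodge_mulr// hodge_mull//.
rewrite !(mulNmx, mulmxN) opprK !mul_scalar_mx !mul_mx_scalar !addrN.
rewrite !scale_scalar_mx -!raddfD /= -expr2 (addrC (- _)).
by rewrite [RHS]scalar_mx_block.
Qed.

Lemma clifford_so44 {R : realType} (a : R) (s : 'M[R]_4) : skew s ->
  so44 (clifford a s).
Proof.
move=> skew_s; rewrite /so44 /= /form44 /clifford tr_block_mx !mulmx_block.
rewrite !(mulmx0, mul0mx, mulmx1, mul1mx, add0r, addr0) add_block_mx.
rewrite linearN /= tr_scalar_mx skew_s hodge_skew !addNr !addrN.
by rewrite block_mx_const.
Qed.

(* Cl^0(4,3) = M_8(R), so its 8-dimensional real module is the spin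
   representation; spin(4,3) is spanned by the commutators of vectors. *)
Definition spin43 {R : realType} : set 'M[R]_8 :=
  [set A | exists (m : nat) (a b : 'I_m -> R) (s x : 'I_m -> 'M[R]_4),
     [/\ forall i, skew (s i), forall i, skew (x i) &
         A = \sum_(i < m) (clifford (a i) (s i) *m clifford (b i) (x i)
                           - clifford (b i) (x i) *m clifford (a i) (s i))]].

(* Coordinates on R^6 are (x1, x2, x3, y1, y2, y3); f is a function of
   (x1, x3). *)
Definition x13 {R : realType} (q : 'rV[R]_6) : 'rV[R]_2 :=
  \row_(j < 2) if j == 0 then q 0 0 else q 0 2.

Definition f_3 {R : realType} (f : 'rV[R]_2 -> R) : 'rV[R]_2 -> R := pd 1 f.
Definition f_33 {R : realType} (f : 'rV[R]_2 -> R) : 'rV[R]_2 -> R :=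
  pd 1 (f_3 f).
Definition f_13 {R : realType} (f : 'rV[R]_2 -> R) : 'rV[R]_2 -> R :=
  pd 0 (f_3 f).

Definition dcoord {R : realType} (i : 'I_6) : 'rV[R]_6 := delta_mx 0 i.

Definition theta1 {R : realType} (q : 'rV[R]_6) : 'rV[R]_6 :=
  dcoord 3 + q 0 1 *: dcoord 2.
Definition theta2 {R : realType} (f : 'rV[R]_2 -> R) (q : 'rV[R]_6) : 'rV[R]_6 :=
  dcoord 4 + f (x13 q) *: dcoord 0.
Definition theta3 {R : realType} (q : 'rV[R]_6) : 'rV[R]_6 :=
  dcoord 5 + q 0 0 *: dcoord 1.
Definition theta4 {R : realType} (f : 'rV[R]_2 -> R) (q : 'rV[R]_6) : 'rV[R]_6 :=
  (3 / 2 * f_3 f (x13 q) ^+ 2) *: dcoord 0.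
Definition theta5 {R : realType} (f : 'rV[R]_2 -> R) (q : 'rV[R]_6) : 'rV[R]_6 :=
  (3 / 2 * f_3 f (x13 q)) *: dcoord 1
  - (1 / 2 * f_33 f (x13 q)) *: theta1 q.
Definition theta6 {R : realType} (f : 'rV[R]_2 -> R) (q : 'rV[R]_6) : 'rV[R]_6 :=
  (3 / 2 * f_3 f (x13 q) ^+ 2) *: dcoord 2
  + (1 / 2 * f_13 f (x13 q)) *: theta2 f q.

(* The matrix of 2 a b, where a b is the symmetrised tensor product of the
   covectors a and b. *)
Definition twice_prod {R : realType} {n : nat} (a b : 'rV[R]_n) : 'M[R]_n :=
  a^T *m b + b^T *m a.

Definition bryant_metric {R : realType} (f : 'rV[R]_2 -> R) (q : 'rV[R]_6) :
  'M[R]_6 :=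
  twice_prod (theta1 q) (theta4 f q) + twice_prod (theta2 f q) (theta5 f q)
  + twice_prod (theta3 q) (theta6 f q).

(* Coordinates on R^8 are (t, x1, x2, x3, y1, y2, y3, rho). *)
Definition coord_t {R : realType} (u : 'rV[R]_8) : R := u 0 0.
Definition coord_rho {R : realType} (u : 'rV[R]_8) : R := u 0 7.
Definition base {R : realType} (u : 'rV[R]_8) : 'rV[R]_6 :=
  lsubmx (rsubmx (u : 'rV[R]_(1 + (6 + 1)))).

(* 2 d(rho t) dt = 2 rho dt^2 + 2 t d(rho) dt. *)
Definition ambient_metric {R : realType} (f : 'rV[R]_2 -> R) (u : 'rV[R]_8) :
  'M[R]_8 :=
  let t := coord_t u in
  let rho := coord_rho u in
  let g : 'M[R]_6 := t ^+ 2 *: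
    (bryant_metric f (base u)
     + (2 * rho) *: schouten6 (bryant_metric f) (base u)) in
  block_mx (2 * rho)%:M (row_mx 0 t%:M)
           (col_mx 0 t%:M) (block_mx g 0 0 0) : 'M[R]_(1 + (6 + 1)).

(* Main.v *)
(** In the coordinates v = (rho, x2, y1, y3) and w = (t, x1, x3, y2) the ambient
metric is 2 dv^T B dw + dw^T C dw with B a function of w and C affine in v, so
the coordinate fields of v span a parallel totally null distribution.  On the
quotient, d (t^2 f_3^(4/3) theta2) is a parallel symplectic form, which reduces
gl_4 to sp_2; moving the complementary null distribution by the multiple
-(3/8) x2 f_3^(-1/3) of J removes the J-component of the connection.  Hence in an
explicit frame the connection form takes values in po(3,2).  This is a finite
computation with polynomials in x1, x2, rho and the jets of f which are Laurent
in t and in the cube root of f_3; it is carried out on syntactic polynomials.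

In such a frame parallel transport solves V' = - A V with A in po(3,2), and the
polynomial equations of the corresponding group are first integrals of this
system.  Exchanging e_1, e_4 with f_1, f_4 in R^8 = R^4 + R^4* moves po(3,2) into
spin(4,3): in the half-spin module of the stabilised 4-plane, which is
R + Lambda^2 R^4 + R, it exchanges J with a vector fixed by spin(4,3). *)
From Stdlib Require Import ZArith.
Require Import Defs.
From HB Require Import structures.
From mathcomp Require Import all_boot all_order all_algebra.
From mathcomp Require Import all_classical all_reals all_analysis.
From mathcomp Require Import ring lra zify ssrZ.

Set Implicit Arguments.
Unset Strict Implicit.
Unset Printing Implicit Defensive.

Import Order.TTheory GRing.Theory Num.Theory.
Import numFieldNormedType.Exports.

(** * Polynomials in jets *)

(** That the null distribution and the symplectic form are parallel is never proved as such: both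
    facts are contained in the shape of the connection matrices. The input is a frame with constant
    Gram matrix [form44], which also yields the inverse metric and the dual coframe as products, so
    that nothing is inverted symbolically. The exponent 4/3 forces a symbol k with k^3 = f_3; the
    other jets are independent variables, so one computation covers every f. Mixed derivatives must
    be brought to the order d_1^a d_3^b, which requires Schwarz's theorem. Neither the solution
    theory of linear differential equations nor the Lie correspondence is invoked. A function of the
    parallel frame with zero derivative is constant by the mean value theorem, and an element of the
    holonomy algebra is the velocity at 0 of a one-parameter family, so it suffices to differentiate
    the group equations at the identity. The delicate equation is the one for the translation part:
    it is constant along a solution only in conjunction with the other two. *)

Local Open Scope nat_scope.

(* [(c, n)] stands for [c / 6 ^ n]: only the primes 2 and 3 occur in
   denominators.  Stdlib integers keep the computations of [vm_compute] feasible
   for the kernel without the virtual machine as well. *)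
Definition coef := (Z * nat)%type.

Definition pow6 (n : nat) : Z := iter n (Z.mul 6) (Zpos 1).

(** Subtraction is truncated, so the common exponent is the larger one and at most one numerator is
    rescaled. *)
Definition add_coef (a b : coef) : coef :=
  (Z.add (Z.mul a.1 (pow6 (b.2 - a.2))) (Z.mul b.1 (pow6 (a.2 - b.2))),
   a.2 + (b.2 - a.2)).

Definition mul_coef (a b : coef) : coef := (Z.mul a.1 b.1, a.2 + b.2).

(* [(0, 0)], [(0, 1)], [(0, 2)] are x1, x2, rho, and [(a.+1, b)] is the jet
   d_1^a d_3^b f *)
Definition var := (nat * nat)%type.

Definition vcmp (v w : var) : comparison :=
  if Nat.compare v.1 w.1 is Eq then Nat.compare v.2 w.2
  else Nat.compare v.1 w.1.

Definition veq (v w : var) : bool := if vcmp v w is Eq then true else false.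

(** Insertion into a sorted list gives equal monomials the same representative, so that
    cancellations are detected by comparison; the value is correct for any list. *)
Fixpoint vins (v : var) (e : nat) (l : seq (var * nat)) : seq (var * nat) :=
  if e is 0 then l else
  if l is (w, d) :: l' then
    match vcmp v w with
    | Eq => (w, e + d) :: l'
    | Lt => (v, e) :: l
    | Gt => (w, d) :: vins v e l'
    end
  else [:: (v, e)].

(* t^tdeg (f_3)^(kdeg / 3) times a product of variables *)
Record mono := Mono {tdeg : Z; kdeg : Z; vdeg : seq (var * nat)}.

Definition mmul (m n : mono) : mono :=
  Mono (Z.add (tdeg m) (tdeg n)) (Z.add (kdeg m) (kdeg n))
    (foldr (fun x => vins x.1 x.2) (vdeg n) (vdeg m)).

Fixpoint vdeg_eq (l l' : seq (var * nat)) : bool :=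
  match l, l' with
  | [::], [::] => true
  | (v, e) :: l, (w, d) :: l' => [&& veq v w, Nat.eqb e d & vdeg_eq l l']
  | _, _ => false
  end.

Definition meq (m n : mono) : bool :=
  [&& Z.eqb (kdeg m) (kdeg n), Z.eqb (tdeg m) (tdeg n)
    & vdeg_eq (vdeg m) (vdeg n)].

Definition jpoly := seq (coef * mono).

(** Like monomials are merged and zero terms dropped, so an identity can be tested by whether a
    difference is the empty list. Only the soundness of this test matters. *)
Fixpoint pins (c : coef) (m : mono) (p : jpoly) : jpoly :=
  if Z.eqb c.1 0 then p else
  if p is (d, n) :: p' then
    if meq m n then
      let s := add_coef c d in if Z.eqb s.1 0 then p' else (s, n) :: p'
    else (d, n) :: pins c m p'
  else [:: (c, m)].

Definition padd (p q : jpoly) : jpoly :=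
  foldr (fun x => pins x.1 x.2) q p.

Definition pmul (p q : jpoly) : jpoly :=
  foldr (fun x r => foldr (fun y => pins (mul_coef x.1 y.1) (mmul x.2 y.2)) r q)
    [::] p.

Definition pterm (c : coef) (m : mono) : jpoly := [:: (c, m)].
Definition pconst (c : coef) : jpoly := pterm c (Mono 0 0 [::]).
Definition pscale (c : coef) (p : jpoly) : jpoly := pmul (pconst c) p.
Definition psub (p q : jpoly) : jpoly := padd p (pscale (Zneg 1, 0) q).
Definition psum (n : nat) (F : nat -> jpoly) : jpoly :=
  foldr (fun i => padd (F i)) [::] (iota 0 n).

Definition ptk (a b : Z) : jpoly := pterm (Zpos 1, 0) (Mono a b [::]).
Definition pX1 : jpoly := pterm (Zpos 1, 0) (Mono 0 0 [:: ((0, 0), 1)]).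
Definition pX2 : jpoly := pterm (Zpos 1, 0) (Mono 0 0 [:: ((0, 1), 1)]).
Definition prho : jpoly := pterm (Zpos 1, 0) (Mono 0 0 [:: ((0, 2), 1)]).

(* f_3 is never a variable: it is the cube of the symbol k of degree [kdeg] *)
Definition pjet (a b : nat) : jpoly :=
  match a, b with
  | 0, 1 => ptk 0 3
  | _, _ => pterm (Zpos 1, 0) (Mono 0 0 [:: ((a.+1, b), 1)])
  end.

(* [dvar i], [dt i], [dk i], [pD i] differentiate along the coordinate [i] of R^8,
   0 being t, 1 to 6 being x1, ..., y3, and 7 being rho *)
Definition dvar (i : nat) (v : var) : jpoly :=
  match v, i with
  | (0, 0), 1 | (0, 1), 2 | (0, _.+2), 7 => pconst (Zpos 1, 0)
  | (a.+1, b), 1 => pjet a.+1 b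
  | (a.+1, b), 3 => pjet a b.+1
  | _, _ => [::]
  end.

Definition dt (i : nat) : jpoly := if i is 0 then pconst (Zpos 1, 0) else [::].

(* k' = f_3' / (3 k^2) for k = f_3^(1/3) *)
Definition dk (i : nat) : jpoly :=
  match i with
  | 1 => pmul (pterm (Zpos 2, 1) (Mono 0 (Zneg 2) [::])) (pjet 1 1)
  | 3 => pmul (pterm (Zpos 2, 1) (Mono 0 (Zneg 2) [::])) (pjet 0 2)
  | _ => [::]
  end.

(** The exponent [e.-1] may be 0; the product reinserts the variables through [vins], which discards
    it. *)
Fixpoint dvdeg (i : nat) (l : seq (var * nat)) : jpoly :=
  if l is (v, e) :: l' then
    padd (pmul (pterm (Z.of_nat e, 0) (Mono 0 0 ((v, e.-1) :: l'))) (dvar i v))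
         (pmul (pterm (Zpos 1, 0) (Mono 0 0 [:: (v, e)])) (dvdeg i l'))
  else [::].

Definition dmono (i : nat) (m : mono) : jpoly :=
  let: Mono a b l := m in
  padd (pmul (pterm (a, 0) (Mono (Z.pred a) b l)) (dt i))
    (padd (pmul (pterm (b, 0) (Mono a (Z.pred b) l)) (dk i))
          (pmul (ptk a b) (dvdeg i l))).

Definition pD (i : nat) (p : jpoly) : jpoly :=
  foldr (fun x => padd (pscale x.1 (dmono i x.2))) [::] p.

(** * Matrices of jet polynomials, Christoffel symbols and Ricci tensor *)

Definition pmx := nat -> nat -> jpoly.

(* tabulation: call-by-value evaluation computes every entry once *)
Definition memo2 (n : nat) (A : pmx) : pmx :=
  let l := [seq [seq A i j | j <- iota 0 n] | i <- iota 0 n] in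
  fun i j => nth [::] (nth [::] l i) j.
Definition memo3 (n : nat) (A : nat -> pmx) : nat -> pmx :=
  let l := [seq [seq [seq A i j k | k <- iota 0 n] | j <- iota 0 n]
           | i <- iota 0 n] in
  fun i j k => nth [::] (nth [::] (nth [::] l i) j) k.

Definition pmulmx (n : nat) (A B : pmx) : pmx :=
  fun i j => psum n (fun k => pmul (A i k) (B k j)).
Definition psubmx (A B : pmx) : pmx := fun i j => psub (A i j) (B i j).
Definition ptr (A : pmx) : pmx := fun i j => A j i.
Definition pdelta (i j : nat) : jpoly :=
  if Nat.eqb i j then pconst (Zpos 1, 0) else [::].

(* the coordinate i of R^n is the coordinate s + i of R^8 *)
Definition pchristoffel (n s : nat) (G GI : pmx) : nat -> pmx :=
  let dG := memo3 n (fun a i j => pD (s + a) (G i j)) in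
  fun k i j => pscale (Zpos 3, 1) (psum n (fun l =>
    pmul (GI k l) (psub (padd (dG i j l) (dG j i l)) (dG l i j)))).

Definition pricci (n s : nat) (C : nat -> pmx) : pmx := fun i j =>
  psum n (fun k =>
    padd (psub (pD (s + k) (C k i j)) (pD (s + j) (C k i k)))
      (psum n (fun l => psub (pmul (C k k l) (C l i j))
                             (pmul (C k j l) (C l i k))))).

(** * Bryant's metric, the ambient metric and the adapted frame as symbolic matrices *)

Definition pcov (l : seq (nat * jpoly)) : nat -> jpoly := fun i =>
  foldr (fun x r => if Nat.eqb x.1 i then x.2 else r) [::] l.
Definition pone := pconst (Zpos 1, 0).
Definition c32 : coef := (Zpos 9, 1).
Definition c12 : coef := (Zpos 3, 1).
Definition pth1 := pcov [:: (3, pone); (2, pX2)].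
Definition pth2 := pcov [:: (4, pone); (0, pjet 0 0)].
Definition pth3 := pcov [:: (5, pone); (1, pX1)].
Definition pth4 := pcov [:: (0, pscale c32 (ptk 0 6))].
Definition pth5 i := psub (pcov [:: (1, pscale c32 (ptk 0 3))] i)
  (pmul (pscale c12 (pjet 0 2)) (pth1 i)).
Definition pth6 i := padd (pcov [:: (2, pscale c32 (ptk 0 6))] i)
  (pmul (pscale c12 (pjet 1 1)) (pth2 i)).
Definition ptwice (a b : nat -> jpoly) : pmx := fun i j =>
  padd (pmul (a i) (b j)) (pmul (b i) (a j)).
Definition pbryant : pmx := memo2 6 (fun i j =>
  padd (padd (ptwice pth1 pth4 i j) (ptwice pth2 pth5 i j))
    (ptwice pth3 pth6 i j)).
Definition pnil (p : jpoly) : bool := if p is [::] then true else false.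
Definition peqmx (n : nat) (A B : pmx) : bool :=
  all (fun i => all (fun j => pnil (psub (A i j) (B i j))) (iota 0 n))
    (iota 0 n).

Definition c23 : coef := (Zpos 4, 1).
Definition c13 : coef := (Zpos 2, 1).
Definition neg1 : coef := (Zneg 1, 0).

(* the columns are the frame dual to theta1, ..., theta6 *)
Definition pbryant_frame : pmx := fun i j =>
  let a := pscale c13 (pmul (ptk 0 (Zneg 3)) (pjet 0 2)) in
  let b := pscale (Zneg 2, 1) (pmul (ptk 0 (Zneg 6)) (pjet 1 1)) in
  let c := pscale c23 (ptk 0 (Zneg 6)) in
  let d := pscale c23 (ptk 0 (Zneg 3)) in
  match i, j with
  | 0, 3 | 2, 5 => c
  | 1, 0 => a
  | 1, 4 => d
  | 2, 1 => b
  | 3, 0 | 4, 1 | 5, 2 => pone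
  | 3, 1 => pscale neg1 (pmul pX2 b)
  | 3, 5 => pscale neg1 (pmul pX2 c)
  | 4, 3 => pscale neg1 (pmul (pjet 0 0) c)
  | 5, 0 => pscale neg1 (pmul pX1 a)
  | 5, 4 => pscale neg1 (pmul pX1 d)
  | _, _ => [::]
  end.
(** In the dual frame E the metric is the constant matrix H pairing k with k + 3 modulo 6, so its
    inverse is E H E^T. *)
Definition pbryant_inv : pmx := memo2 6 (fun i j =>
  psum 6 (fun k => pmul (pbryant_frame i k) (pbryant_frame j ((k + 3) %% 6)))).
Definition pbryant_chr : nat -> pmx :=
  memo3 6 (pchristoffel 6 1 pbryant pbryant_inv).
Definition pbryant_ricci : pmx := memo2 6 (pricci 6 1 pbryant_chr).
Definition pbryant_scal : jpoly :=
  psum 6 (fun i => psum 6 (fun j => pmul (pbryant_inv i j) (pbryant_ricci i j))).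

(** The scalar curvature vanishes ([pbryant_scal_eq0]), so P = Ric / 4 and 2 rho P = rho Ric / 2. *)
Definition pambient : pmx := memo2 8 (fun i j =>
  match i, j with
  | 0, 0 => pscale (Zpos 2, 0) prho
  | 0, 7 | 7, 0 => ptk 1 0
  | i'.+1, j'.+1 => if (i' < 6) && (j' < 6) then
      pmul (ptk 2 0)
        (padd (pbryant i' j') (pmul prho (pscale c12 (pbryant_ricci i' j'))))
      else [::]
  | _, _ => [::]
  end).

(* the coordinates w = (t, x1, x3, y2) and v = (rho, x2, y1, y3) *)
Definition widx (i : nat) : nat := nth 0 [:: 0; 1; 3; 5] i.
Definition vidx (i : nat) : nat := nth 0 [:: 7; 2; 4; 6] i.

(* The rows are a symplectic coframe of d (t^2 f_3^(4/3) theta2):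
   2 t k^4 theta2, t k^7 dx1, t dx3 and dt + (2 t / 3) d log f_3. *)
Definition pK : pmx := fun i j => match i, j with
  | 0, 3 => pscale (Zpos 2, 0) (ptk 1 4)
  | 0, 1 => pscale (Zpos 2, 0) (pmul (pjet 0 0) (ptk 1 4))
  | 1, 1 => ptk 1 7
  | 2, 2 => ptk 1 0
  | 3, 0 => pone
  | 3, 1 => pscale c23 (pmul (ptk 1 (Zneg 3)) (pjet 1 1))
  | 3, 2 => pscale c23 (pmul (ptk 1 (Zneg 3)) (pjet 0 2))
  | _, _ => [::]
  end.
Definition pKinv : pmx := fun i j => match i, j with
  | 0, 1 => pscale (Zneg 4, 1) (pmul (ptk 0 (Zneg 10)) (pjet 1 1))
  | 0, 2 => pscale (Zneg 4, 1) (pmul (ptk 0 (Zneg 3)) (pjet 0 2))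
  | 0, 3 => pone
  | 1, 1 => ptk (Zneg 1) (Zneg 7)
  | 2, 2 => ptk (Zneg 1) 0
  | 3, 0 => pscale c12 (ptk (Zneg 1) (Zneg 4))
  | 3, 1 => pscale neg1 (pmul (pjet 0 0) (ptk (Zneg 1) (Zneg 7)))
  | _, _ => [::]
  end.
(* the inverse transpose of the block B of the metric *)
Definition pBinvT : pmx := fun i j => match i, j with
  | 0, 0 => ptk (Zneg 1) 0
  | i'.+1, j'.+1 => pmul (ptk (Zneg 2) 0) (pbryant_inv (vidx i).-1 (widx j).-1)
  | _, _ => [::]
  end.
Definition pC : pmx := fun i j => pambient (widx i) (widx j).
Definition pJ4 : pmx := fun i j => if Nat.eqb (i + j) 3 then
  pconst (if Nat.ltb i 2 then Zneg 1 else Zpos 1, 0) else [::].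
(* the multiple -(3/8) x2 f_3^(-1/3) of J *)
Definition pS : pmx := fun i j =>
  pmul (pscale (Zneg 81, 3) (pmul pX2 (ptk 0 (Zneg 1)))) (pJ4 i j).
Definition pL : pmx := memo2 4 (pmulmx 4 pBinvT (ptr pK)).
Definition pR : pmx := memo2 4 (psubmx
  (fun i j => pscale (Zneg 3, 1)
    (pmulmx 4 pBinvT (memo2 4 (pmulmx 4 pC pKinv)) i j))
  (pmulmx 4 pL pS)).
(* In the coordinates (v, w) the frame is [[L, R], [0, K^-1]] with
   L = B^-T K^T and R = - B^-T C K^-1 / 2 - L S. *)
Definition pframe : pmx := memo2 8 (fun i j =>
  let k := nth 0 [:: 4; 5; 1; 6; 2; 7; 3; 0] i in
  if k < 4 then if j < 4 then pL k j else pR k (j - 4)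
  else if j < 4 then [::] else pKinv (k - 4) (j - 4)).
Definition shift4 (i : nat) : nat := if i < 4 then i + 4 else i - 4.
(** With F = [form44] = F^-1, a frame E with E^T g E = F has inverse F E^T g, and g has inverse E F
    E^T. These are the formulas used here and for [pambient_inv]; [shift4] is the permutation given
    by F. *)
Definition pcoframe : pmx := memo2 8 (fun i j =>
  psum 8 (fun k => pmul (pframe k (shift4 i)) (pambient k j))).
Definition pambient_inv : pmx := memo2 8 (fun i j =>
  psum 8 (fun k => pmul (pframe i k) (pframe j (shift4 k)))).
Definition pambient_chr : nat -> pmx :=
  memo3 8 (pchristoffel 8 0 pambient pambient_inv).

(** The connection matrix E^-1 (Gamma_a E + d_a E) equals (E^-1 Gamma_a - d_a E^-1) E, as d_a (E^-1
    E) = 0. The bracket is tabulated here. *)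
Definition pconnection_left (a : nat) : pmx :=
  memo2 8 (psubmx (pmulmx 8 pcoframe (fun k b => pambient_chr k a b))
                  (fun i j => pD a (pcoframe i j))).
Definition pconnection (a : nat) : pmx :=
  let N := pconnection_left a in memo2 8 (pmulmx 8 N pframe).

Definition pwedge (s x : pmx) : jpoly :=
  padd (psub (padd (padd (psub (pmul (s 0 1) (x 2 3)) (pmul (s 0 2) (x 1 3)))
    (pmul (s 0 3) (x 1 2))) (pmul (s 1 2) (x 0 3))) (pmul (s 1 3) (x 0 2)))
    (pmul (s 2 3) (x 0 1)).

Definition pzero : pmx := fun _ _ => [::].

(** The condition that the upper left block has trace 0 is left to [sp_trace], which derives it from
    the symplectic condition. *)
Definition ppo32 (X : pmx) : bool :=
  let Z := fun i j => X i (4 + j) in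
  [&& peqmx 4 (fun i j => X (4 + i) j) pzero,
      peqmx 4 (fun i j => X (4 + i) (4 + j)) (psubmx pzero (ptr X)),
      peqmx 4 (ptr Z) (psubmx pzero Z),
      peqmx 4 (pmulmx 4 X pJ4) (psubmx pzero (pmulmx 4 pJ4 (ptr X)))
    & pnil (pwedge Z pJ4)].

(** * The finite computations *)

Lemma pbryant_invP : peqmx 6 (pmulmx 6 pbryant pbryant_inv) pdelta.
Proof. by vm_compute. Qed.

Lemma pbryant_scal_eq0 : pnil pbryant_scal.
Proof. by vm_compute. Qed.

Lemma pambient_invP : peqmx 8 (pmulmx 8 pambient pambient_inv) pdelta.
Proof. by vm_compute. Qed.

Lemma pframe_dual : peqmx 8 (pmulmx 8 pcoframe pframe) pdelta.
Proof. by vm_compute. Qed.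

(** The computational core: the linear equations of po(3,2) hold identically in t, k, x1, x2, rho
    and the jets of f taken as independent variables. *)
Lemma pconnection_po32 : all (fun a => ppo32 (pconnection a)) (iota 0 8).
Proof. by vm_compute. Qed.

Local Open Scope classical_set_scope.
Local Open Scope ring_scope.

(** * Evaluation of jet polynomials at real values *)

Section Evaluation.
Context {R : realType} (tau kappa : R) (val : var -> R).

Definition cval (c : coef) : R := (int_of_Z c.1)%:~R / 6 ^+ c.2.
Definition lval (l : seq (var * nat)) : R := \prod_(x <- l) val x.1 ^+ x.2.
Definition mval (m : mono) : R :=
  tau ^ int_of_Z (tdeg m) * kappa ^ int_of_Z (kdeg m) * lval (vdeg m).
Definition pval (p : jpoly) : R := \sum_(x <- p) cval x.1 * mval x.2.

Lemma int_of_Z_add (a b : Z) : int_of_Z (Z.add a b) = int_of_Z a + int_of_Z b.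
Proof. by lia. Qed.
Lemma int_of_Z_mul (a b : Z) : int_of_Z (Z.mul a b) = int_of_Z a * int_of_Z b.
Proof. by lia. Qed.

Lemma cvalM c d : cval (mul_coef c d) = cval c * cval d.
Proof.
by rewrite /cval int_of_Z_mul intrM exprD invfM mulrACA.
Qed.

Lemma pow6E n : (int_of_Z (pow6 n))%:~R = 6 ^+ n :> R.
Proof.
elim: n => [|n IHn]; first by rewrite expr0.
by rewrite /pow6 iterS int_of_Z_mul intrM IHn exprS.
Qed.

Lemma cvalD c d : cval (add_coef c d) = cval c + cval d.
Proof.
have n6 n : (6 : R) ^+ n != 0 by rewrite expf_neq0// pnatr_eq0.
have e : (c.2 + (d.2 - c.2) = d.2 + (c.2 - d.2))%N by rewrite -!maxnE maxnC.
rewrite /cval /add_coef /= int_of_Z_add !int_of_Z_mul intrD !intrM !pow6E.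
by rewrite mulrDl {2}e !exprD -!mulf_div !divff// !mulr1.
Qed.

Lemma cval0 c : Z.eqb c.1 0 -> cval c = 0.
Proof. by move/Z.eqb_spec => e; rewrite /cval e mul0r. Qed.

Lemma vcmp_eq v w : vcmp v w = Eq -> v = w.
Proof.
case: v w => [a b] [c d]; rewrite /vcmp /=; case E: (Nat.compare a c) => //.
by move/Nat.compare_eq ->; move/Nat.compare_eq: E => ->.
Qed.

Lemma lval_ins v e l : lval (vins v e l) = val v ^+ e * lval l.
Proof.
case: e => [|e]; first by case: l => *; rewrite expr0 mul1r.
elim: l => [|[w d] l IHl] /=; rewrite ?expr0 ?mul1r//.
  by rewrite /lval big_seq1 big_nil mulr1.
case E: vcmp; rewrite /lval !big_cons //=.
  by rewrite (vcmp_eq E) exprD mulrA.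
by rewrite -/(lval _) IHl mulrCA.
Qed.

Lemma lval_cat l l' :
  lval (foldr (fun x => vins x.1 x.2) l' l) = lval l * lval l'.
Proof.
elim: l => [|x l IHl] /=; first by rewrite /lval big_nil mul1r.
by rewrite lval_ins IHl mulrA /lval big_cons.
Qed.

Hypotheses (tau0 : tau != 0) (kappa0 : kappa != 0).

Lemma mvalM m n : mval (mmul m n) = mval m * mval n.
Proof.
rewrite /mval /= !int_of_Z_add !expfzDr// lval_cat.
by rewrite [RHS]mulrACA [X in _ = X * _]mulrACA.
Qed.

Lemma vdeg_eqP l l' : vdeg_eq l l' -> l = l'.
Proof.
elim: l l' => [|[v e] l IHl] [|[w d] l'] //= /and3P[].
rewrite /veq; case E: vcmp => // _ /Nat.eqb_spec -> /IHl ->.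
by rewrite (vcmp_eq E).
Qed.

Lemma meqP m n : meq m n -> m = n.
Proof.
case: m n => [a b l] [a' b' l'] /and3P[/= /Z.eqb_spec -> /Z.eqb_spec ->].
by move/vdeg_eqP ->.
Qed.

Lemma pval_nil : pval [::] = 0. Proof. exact: big_nil. Qed.

Lemma pval_cons x p : pval (x :: p) = cval x.1 * mval x.2 + pval p.
Proof. exact: big_cons. Qed.

Lemma pval_ins c m p : pval (pins c m p) = cval c * mval m + pval p.
Proof.
elim: p => [|[d n] p IHp] /=; case: ifPn => [/cval0->|_]; rewrite ?mul0r ?add0r//.
  exact: pval_cons.
case: ifPn => [/meqP ->|_]; last first.
  by rewrite !pval_cons IHp /= addrCA.
rewrite pval_cons /= addrA -mulrDl -cvalD.
by case: ifPn => [/(@cval0 (add_coef c d)) ->|_];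
  rewrite ?mul0r ?add0r// pval_cons.
Qed.

Lemma pvalD p q : pval (padd p q) = pval p + pval q.
Proof.
elim: p => [|x p IHp] /=; first by rewrite pval_nil add0r.
by rewrite pval_ins IHp pval_cons addrA.
Qed.

Lemma pvalM p q : pval (pmul p q) = pval p * pval q.
Proof.
elim: p => [|x p IHp] /=; first by rewrite pval_nil mul0r.
rewrite pval_cons mulrDl -IHp; set r := pmul p q.
elim: q {IHp} r => [|y q IHq] r /=; first by rewrite pval_nil mulr0 add0r.
by rewrite pval_ins IHq pval_cons cvalM mvalM mulrDr mulrACA addrA.
Qed.

Lemma pval_term c m : pval (pterm c m) = cval c * mval m.
Proof. exact: big_seq1. Qed.

Lemma pval_const c : pval (pconst c) = cval c.
Proof. by rewrite pval_term /mval /lval big_nil !expr0z !mulr1. Qed.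

Lemma pvalZ c p : pval (pscale c p) = cval c * pval p.
Proof. by rewrite pvalM pval_const. Qed.

Lemma pvalB p q : pval (psub p q) = pval p - pval q.
Proof.
rewrite pvalD pvalZ; congr (_ + _).
by rewrite /cval /= expr0 invr1 mulr1 mulN1r.
Qed.

Lemma pval_sum n F : pval (psum n F) = \sum_(i < n) pval (F i).
Proof.
rewrite -(big_mkord xpredT (fun i => pval (F i))) /index_iota subn0 /psum.
by elim: (iota 0 n) => [|i l IHl] /=;
  rewrite ?big_nil ?pval_nil// pvalD IHl big_cons.
Qed.

Lemma pval_one : pval pone = 1.
Proof. by rewrite pval_const /cval /= expr0 divr1. Qed.

Lemma pval_delta i j : pval (pdelta i j) = (i == j)%:R.
Proof.
rewrite /pdelta; case: ifPn => [/Nat.eqb_spec ->|/Nat.eqb_spec/eqP/negPf ->].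
  by rewrite eqxx pval_one.
exact: pval_nil.
Qed.

Lemma pval_tk a b : pval (ptk a b) = tau ^ int_of_Z a * kappa ^ int_of_Z b.
Proof.
by rewrite pval_term /mval /lval /= big_nil mulr1 /cval /= expr0 divr1 mul1r.
Qed.

Lemma pval_var v : pval (pterm (Zpos 1, 0%N) (Mono 0 0 [:: (v, 1%N)])) = val v.
Proof.
by rewrite pval_term /mval /lval /= big_seq1 /cval /= expr0 divr1 !mul1r.
Qed.

Hypothesis kappa3 : kappa ^+ 3 = val (1, 1)%N.

Lemma pval_jet a b : pval (pjet a b) = val (a.+1, b).
Proof.
by case: a b => [|a] [|[|b]];
  rewrite /pjet ?pval_var// pval_tk expr0z mul1r -kappa3.
Qed.

End Evaluation.

Lemma memo2E n A i j : (i < n)%N -> (j < n)%N -> memo2 n A i j = A i j.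
Proof.
move=> ? ?; rewrite /memo2 (nth_map 0%N) ?size_iota// nth_iota//.
by rewrite (nth_map 0%N) ?size_iota// nth_iota.
Qed.
Lemma memo3E n A i j k : (i < n)%N -> (j < n)%N -> (k < n)%N ->
  memo3 n A i j k = A i j k.
Proof.
move=> ? ? ?; rewrite /memo3 (nth_map 0%N) ?size_iota// nth_iota//.
rewrite (nth_map 0%N) ?size_iota// nth_iota//.
by rewrite (nth_map 0%N) ?size_iota// nth_iota.
Qed.

Arguments padd : simpl never.
Arguments pmul : simpl never.
Arguments pterm : simpl never.

(** * Differentiation of jet polynomials *)

Section DerivationRules.
Context {R : realType} {V : normedModType R}.
Implicit Types (f g : V -> R) (x v : V).

Lemma is_derive_fctM f g x v df dg : is_derive x v f df -> is_derive x v g dg ->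
  is_derive x v (fun y => f y * g y) (f x * dg + g x * df).
Proof. by move=> ? ?; exact: is_deriveM. Qed.

Lemma is_derive_fctD f g x v df dg : is_derive x v f df -> is_derive x v g dg ->
  is_derive x v (fun y => f y + g y) (df + dg).
Proof. by move=> ? ?; exact: is_deriveD. Qed.

Lemma is_derive_fctX f x v df n : is_derive x v f df ->
  is_derive x v (fun y => f y ^+ n) (n%:R * f x ^+ n.-1 * df).
Proof.
move=> dfx; have -> : (fun y => f y ^+ n) = f ^+ n.
  by apply/funext => y; rewrite exprfctE.
exact: is_deriveX.
Qed.

Lemma is_derive_fctZ f x v df (k : int) : f x != 0 -> is_derive x v f df ->
  is_derive x v (fun y => f y ^ k) (k%:~R * f x ^ (k - 1) * df).
Proof.
move=> fx0 dfx; case: k => n.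
  case: n => [|n]; last first.
    have -> : Posz n.+1 - 1 = n by lia.
    exact: is_derive_fctX.
  rewrite mulr0z !mul0r (_ : (fun y => _) = cst 1); first exact: is_derive_cst.
  by apply/funext => y; rewrite expr0z.
have dfn := is_derive_fctX n.+1 dfx.
have fn0 : f x ^+ n.+1 != 0 by rewrite expf_neq0.
apply: (@is_derive_eq _ _ _ _ _ _ _
  (- (f x ^+ n.+1) ^- 2 *: (n.+1%:R * f x ^+ n * df))).
  apply: DeriveDef; first by apply: derivableV => //; exact: ex_derive.
  rewrite (@deriveV _ _ (fun y => f y ^+ n.+1) x v fn0); last exact: ex_derive.
  by rewrite derive_val.
have -> : Negz n - 1 = Negz n.+1 by lia.
have -> : f x ^ Negz n.+1 = (f x ^+ n.+2)^-1 by [].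
have -> : (f x ^+ n.+1) ^- 2 = (f x ^+ n)^-1 * (f x ^+ n.+2)^-1.
  by rewrite -invfM -exprM -exprD; congr (_ ^+ _)^-1; lia.
have -> : (Negz n)%:~R = - n.+1%:R :> R by rewrite NegzE mulrNz.
by rewrite /GRing.scale /=; field; rewrite !expf_neq0.
Qed.

Lemma differentiable_fctX f x n : differentiable f x ->
  differentiable (fun y => f y ^+ n) x.
Proof.
move=> dfx; have -> : (fun y => f y ^+ n) = f ^+ n.
  by apply/funext => y; rewrite exprfctE.
case: n => [|n]; last exact: differentiableX.
by rewrite expr0; exact: differentiable_cst.
Qed.

Lemma differentiable_fctZ f x (k : int) : f x != 0 -> differentiable f x ->
  differentiable (fun y => f y ^ k) x.
Proof.
move=> fx0 dfx; have d n := differentiable_fctX n dfx.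
case: k => n; first exact: d.
by apply: differentiableV; [exact: d|rewrite expf_neq0].
Qed.

End DerivationRules.

Section FunctionEvaluation.
Context {R : realType} {V : normedModType R}.
Variables (tau kappa : V -> R) (val : var -> V -> R) (x : V).

Definition peval (p : jpoly) (u : V) : R :=
  pval (tau u) (kappa u) (val ^~ u) p.

Hypotheses (tau0 : tau x != 0) (kappa0 : kappa x != 0).

Lemma lval_fct_nil : (fun u => lval (val ^~ u) [::]) = cst 1.
Proof. by apply/funext => u; rewrite /lval big_nil. Qed.

Lemma lval_fct_cons w e l : (fun u => lval (val ^~ u) ((w, e) :: l)) =
  (fun u => val w u ^+ e * lval (val ^~ u) l).
Proof. by apply/funext => u; rewrite /lval big_cons. Qed.

(** Directional derivatives along the coordinates do not suffice for the chain rule along curves,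
    hence this separate statement. *)
Lemma differentiable_peval p : differentiable tau x -> differentiable kappa x ->
  (forall w, differentiable (val w) x) -> differentiable (peval p) x.
Proof.
move=> dt dk dv.
have dl l : differentiable (fun u => lval (val ^~ u) l) x.
  elim: l => [|[w e] l IHl].
    by rewrite lval_fct_nil; exact: differentiable_cst.
  rewrite lval_fct_cons.
  by apply: differentiableM => //; exact: differentiable_fctX.
elim: p => [|[c [a b l]] p IHp].
  rewrite (_ : peval [::] = cst 0); first exact: differentiable_cst.
  by apply/funext => u; rewrite /peval pval_nil.
rewrite (_ : peval _ = fun u => cval c * (tau u ^ int_of_Z a *
   kappa u ^ int_of_Z b * lval (val ^~ u) l) + peval p u); last first.
  by apply/funext => u; rewrite /peval pval_cons.
apply: differentiableD => //.
apply: differentiableM; first exact: differentiable_cst.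
apply: differentiableM => //.
by apply: differentiableM; exact: differentiable_fctZ.
Qed.

Variables (v : V) (i : nat).
Hypotheses (dtau : is_derive x v tau (peval (dt i) x))
  (dkappa : is_derive x v kappa (peval (dk i) x))
  (dval : forall w, is_derive x v (val w) (peval (dvar i w) x)).

Lemma is_derive_lval l :
  is_derive x v (fun u => lval (val ^~ u) l) (peval (dvdeg i l) x).
Proof.
elim: l => [|[w e] l IHl].
  rewrite lval_fct_nil.
  by rewrite /peval pval_nil; exact: is_derive_cst.
rewrite lval_fct_cons.
apply: is_derive_eq; first exact: is_derive_fctM (is_derive_fctX e (dval w)) IHl.
rewrite /peval /= pvalD// !pvalM// !pval_term /mval /lval /=.
rewrite !big_cons !big_nil /cval /= !expr0 !expr0z !divr1 !mulr1 !mul1r addrC.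
congr (_ + _); rewrite (_ : int_of_Z _ = e) ?pmulrn; last by lia.
by ring.
Qed.

Lemma is_derive_mval m : is_derive x v
  (fun u => mval (tau u) (kappa u) (val ^~ u) m) (peval (dmono i m) x).
Proof.
case: m => a b l.
apply: is_derive_eq.
  apply: is_derive_fctM; last exact: is_derive_lval.
  by apply: is_derive_fctM; exact: is_derive_fctZ.
rewrite /peval /= !pvalD// !pvalM// !pval_term /mval /=.
have e c : int_of_Z (Z.pred c) = int_of_Z c - 1 by lia.
rewrite !e /cval /= !expr0 !divr1 !mul1r /lval !big_nil !mulr1.
by ring.
Qed.

Lemma is_derive_peval p : is_derive x v (peval p) (peval (pD i p) x).
Proof.
elim: p => [|[c m] p IHp].
  rewrite (_ : peval [::] = cst 0); last first.
    by apply/funext => u; rewrite /peval pval_nil.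
  exact: is_derive_cst.
rewrite (_ : peval (_ :: _) = fun u => cval c * mval (tau u) (kappa u)
  (val ^~ u) m + peval p u); last first.
  by apply/funext => u; rewrite /peval pval_cons.
apply: is_derive_eq.
  apply: is_derive_fctD IHp.
  exact: is_derive_fctM (@is_derive_cst _ _ _ (cval c) x v) (is_derive_mval m).
rewrite /peval /= pvalD// pvalZ//.
by rewrite mulr0 addr0.
Qed.

End FunctionEvaluation.

Section AffinePullback.
Context {R : realType} {U V W : normedModType R}.
Variables (F : V -> W) (A : U -> V) (x v : U) (w : V).
Hypothesis affA : forall h : R, A (h *: v + x) = h *: w + A x.

(** The two difference quotients are the same function of h, so no chain rule is needed. *)
Lemma derive_affine : 'D_v (F \o A) x = 'D_w F (A x).
Proof. by rewrite /derive /=; under eq_fun do rewrite affA. Qed.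

Lemma derivable_affine : derivable F (A x) w -> derivable (F \o A) x v.
Proof.
by rewrite /derivable /=; under [in X in _ -> X]eq_fun do rewrite affA.
Qed.

Lemma is_derive_affine : derivable F (A x) w ->
  is_derive x v (F \o A) ('D_w F (A x)).
Proof.
by move=> dF; apply: DeriveDef; [exact: derivable_affine|exact: derive_affine].
Qed.

End AffinePullback.

(** * Symmetry of second derivatives *)

Section Schwarz.
Context {R : realType} {V : normedModType R}.
Implicit Types (F : V -> R) (p v w : V).

Lemma differentiable_bound F p (e : R) : differentiable F p -> 0 < e ->
  \forall x \near (0 : V), `|F (x + p) - F p - 'd F p x| <= e * `|x|.
Proof.
move=> dF e0.
have /eqaddoP /(_ e e0) := diff_locally dF.
by apply: filterS => x /=; rewrite -[(_ - _) x]/(_ - _) /= opprD addrA.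
Qed.

Definition second_difference F p v w (h : R) : R :=
  F (h *: v + (h *: w + p)) - F (h *: v + p) - F (h *: w + p) + F p.

Lemma second_differenceC F p v w h :
  second_difference F p v w h = second_difference F p w v h.
Proof.
by rewrite /second_difference addrCA -!addrA; congr (_ + _); rewrite addrCA.
Qed.

(** The mean value theorem in the direction v turns the second difference into h times an increment
    of ['D_v F], which is expanded to first order at p. Differentiability of ['D_v F] at the single
    point p is enough. *)
Lemma second_difference_bound F p v w (e : R) :
  (\forall x \near p, differentiable F x) -> differentiable ('D_v F) p ->
  0 < e ->
  \forall h \near (0 : R)^'+,
    `|second_difference F p v w h - h ^+ 2 * 'D_w ('D_v F) p| <= e * h ^+ 2.
Proof.
move=> dF dG e0.
set n := `|v| + `|w|.
(* The two points where ['D_v F] is expanded lie within h n and h |v| of p, so errors of rate e / c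
   add up to at most e h; the 1 keeps c positive. *)
set c := n + `|v| + 1.
have n0 : 0 <= n by rewrite addr_ge0.
have c0 : 0 < c by rewrite /c ltr_pwDr// addr_ge0.
have ec0 : 0 < e / c by rewrite divr_gt0.
have := differentiable_bound dG ec0.
move=> /nbhs_norm0P[d1 /= d10 bG].
move: dF; rewrite (near_shift 0) subr0 => /nbhs_norm0P[d2 /= d20 bF].
near=> h.
have h0 : 0 < h by near: h; exact: nbhs_right_gt.
have small s t : 0 <= s <= h -> 0 <= t <= h -> `|s *: v + t *: w| <= h * n.
  move=> /andP[s0 sh] /andP[t0 th].
  rewrite (le_trans (ler_normD _ _))// mulrDr.
  by rewrite !normrZ !ger0_norm// lerD// ler_wpM2r.
have hd (d : R) : 0 < d -> h < d / (n + 1) -> h * n < d.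
  move=> d0; rewrite ltr_pdivlMr ?ltr_wpDl// => /(le_lt_trans _); apply.
  by rewrite ler_pM2l// lerDl.
have hd1 : h * n < d1.
  by apply: hd => //; near: h; apply: nbhs_right_lt; rewrite divr_gt0// ltr_wpDl.
have hd2 : h * n < d2.
  by apply: hd => //; near: h; apply: nbhs_right_lt; rewrite divr_gt0// ltr_wpDl.
have hh : 0 <= h <= h by rewrite ltW//=.
have dphi s t : 0 <= s <= h -> 0 <= t <= h ->
    is_derive s 1 (fun s : R => F (s *: v + (t *: w + p)))
    ('D_v F (s *: v + (t *: w + p))).
  move=> hs ht; apply: (@is_derive_affine _ _ _ _ F
    (fun s : R => s *: v + (t *: w + p)) s 1 v).
    by move=> k; rewrite scalerDl [k *: 1]mulr1 -addrA.
  apply: diff_derivable.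
  have := bF (s *: v + t *: w); rewrite /= addrA; apply.
  by rewrite (le_lt_trans (small _ _ hs ht)).
(* The increment of [psi] over [0, h] is the second difference; [0 *: w] is kept so that [dphi]
   covers both terms. *)
pose psi (s : R) := F (s *: v + (h *: w + p)) - F (s *: v + (0 *: w + p)).
have dpsi (s : R) : 0 <= s <= h -> is_derive s 1 psi
    ('D_v F (s *: v + (h *: w + p)) - 'D_v F (s *: v + (0 *: w + p))).
  by move=> hs; apply: is_deriveB; apply: dphi => //; rewrite lexx ltW.
have [s hs||xi /andP[xi0 xih] mvt] := @MVT R psi (fun s =>
  'D_v F (s *: v + (h *: w + p)) - 'D_v F (s *: v + (0 *: w + p))) 0 h h0.
- by apply: dpsi; move: hs; rewrite in_itv /= => /andP[/ltW -> /ltW ->].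
- apply: derivable_within_continuous => s; rewrite in_itv /= => hs.
  exact: (@ex_derive _ _ _ _ _ _ _ (dpsi s hs)).
rewrite /= in xi0 xih.
have xiP : 0 <= xi <= h by rewrite !ltW.
have e1 : second_difference F p v w h = h *
   ('D_v F ((xi *: v + h *: w) + p) - 'D_v F (xi *: v + p)).
  move: mvt; rewrite /psi subr0 !scale0r !add0r [RHS]mulrC -!addrA => <-.
  by rewrite /second_difference; ring.
have hz : 0 <= (0 : R) <= h by rewrite lexx ltW.
have b1 := bG (xi *: v + h *: w); have b2 := bG (xi *: v).
move: b1 b2; rewrite /= => b1 b2.
have {}b1 := b1 (le_lt_trans (small _ _ xiP hh) hd1).
have b2' : `|xi *: v| <= h * `|v|
  by rewrite normrZ (gtr0_norm xi0) ler_wpM2r// ltW.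
have {}b2 : `|'D_v F (xi *: v + p) - 'D_v F p - 'd ('D_v F) p (xi *: v)|
    <= e / c * `|xi *: v|.
  apply: b2; have := small _ _ xiP hz; rewrite scale0r addr0.
  by move=> /le_lt_trans; apply.
have l2 : 'd ('D_v F) p (xi *: v) = xi * 'd ('D_v F) p v by rewrite linearZ.
have l1 : 'd ('D_v F) p (xi *: v + h *: w) =
    xi * 'd ('D_v F) p v + h * 'd ('D_v F) p w by rewrite linearD !linearZ.
rewrite e1 (deriveE w dG); rewrite l1 in b1; rewrite l2 in b2.
set D := 'd _ _ w in b1 *; set Dv := 'd _ _ v in b1 b2.
(* Two first-order remainders of ['D_v F] at p appear; their linear parts differ by exactly
   [h * D]. *)
have -> : h * ('D_v F (xi *: v + h *: w + p) - 'D_v F (xi *: v + p))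
    - h ^+ 2 * D =
  h * (('D_v F (xi *: v + h *: w + p) - 'D_v F p - (xi * Dv + h * D)) -
       ('D_v F (xi *: v + p) - 'D_v F p - xi * Dv)).
  by ring.
rewrite normrM (gtr0_norm h0) expr2 mulrCA ler_pM2l//.
rewrite (le_trans (ler_normB _ _))//.
rewrite (le_trans (lerD b1 b2))// -mulrDr.
rewrite (@le_trans _ _ (e / c * (h * n + h * `|v|)))//.
  by rewrite ler_pM2l// lerD// small.
rewrite -mulrDr -mulrA ler_pM2l// mulrCA ler_piMr ?(ltW h0)//.
by rewrite mulrC ler_pdivrMr// mul1r lerDl.
Unshelve. all: by end_near. Qed.

(** The second difference is symmetric in v and w, so after division by h^2 it approximates both
    mixed derivatives. *)
Lemma schwarz F p v w : (\forall x \near p, differentiable F x) ->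
  differentiable ('D_v F) p -> differentiable ('D_w F) p ->
  'D_w ('D_v F) p = 'D_v ('D_w F) p.
Proof.
move=> dF dv dw; apply/eqP; rewrite -subr_eq0 -normr_le0.
apply/ler_addgt0Pr => e e0; rewrite add0r.
have e20 : 0 < e / 2 by rewrite divr_gt0.
have bv := second_difference_bound w dF dv e20.
have bw := second_difference_bound v dF dw e20.
have [h [[h0 bvh] bwh]] := filter_ex
  (filterI (filterI (@nbhs_right_gt R 0) bv) bw).
have h20 : 0 < h ^+ 2 by rewrite exprn_gt0.
rewrite -(ler_pM2l h20) -[X in X * `|_|]gtr0_norm// -normrM.
have -> : h ^+ 2 * ('D_w ('D_v F) p - 'D_v ('D_w F) p) =
  (second_difference F p w v h - h ^+ 2 * 'D_v ('D_w F) p) -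
  (second_difference F p v w h - h ^+ 2 * 'D_w ('D_v F) p).
  rewrite (second_differenceC F p w v).
  by rewrite (opprB (second_difference _ _ _ _ _)) [RHS]addrC addrA subrK mulrBr.
apply: (le_trans (ler_normB _ _)); rewrite [leRHS]mulrC (splitr e) mulrDl.
by apply: lerD; [exact: bwh|exact: bvh].
Qed.

End Schwarz.

Arguments pjet : simpl never.
Arguments pconst : simpl never.

(** * The real cube root *)

Section CubeRoot.
Context {R : realType}.
Implicit Types x : R.

(** The sign factor is there because f_3 may be negative. *)
Definition cbrt x : R := Num.sg x * expR (ln `|x| / 3).

Lemma cbrt_exp3 x : x != 0 -> cbrt x ^+ 3 = x.
Proof.
move=> x0; rewrite /cbrt exprMn -expRM_natr divfK// lnK ?posrE ?normr_gt0//.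
by rewrite exprS sqr_sg x0 mulr1 -numEsg.
Qed.

Lemma cbrt_neq0 x : x != 0 -> cbrt x != 0.
Proof. by move=> x0; rewrite mulf_neq0 ?sgr_eq0// gt_eqF ?expR_gt0. Qed.

Lemma cbrtN x : cbrt (- x) = - cbrt x.
Proof. by rewrite /cbrt sgrN normrN mulNr. Qed.

Lemma is_derive_cbrt x : x != 0 -> is_derive x 1 cbrt (3^-1 * (cbrt x) ^- 2).
Proof.
have pos (y : R) : 0 < y -> is_derive y 1 cbrt (3^-1 * (cbrt y) ^- 2).
  move=> y0; apply: (@near_eq_is_derive _ _ _ (expR \o (fun z => ln z * 3^-1))).
    near=> z; have z0 : 0 < z by near: z; exact: lt_nbhsr.
    by rewrite /cbrt gtr0_sg// gtr0_norm// mul1r.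
  apply: is_derive_eq.
    apply: is_derive1_comp.
    exact: is_derive_fctM (is_derive1_ln y0) (is_derive_cst (3^-1 : R) y 1).
  have c0 := cbrt_neq0 (lt0r_neq0 y0).
  rewrite mulr0 add0r /cst.
  have -> : y^-1 = (cbrt y ^+ 3)^-1 by rewrite cbrt_exp3// lt0r_neq0.
  have -> : expR (ln y * 3^-1) = cbrt y.
    by rewrite /cbrt gtr0_sg// gtr0_norm// mul1r.
  by field.
have [x0 _|x0 _|->] := ltgtP x 0; [|exact: pos|by []].
have -> : cbrt = (fun y => - cbrt (- y)) by apply/funext => y;
  rewrite cbrtN opprK.
have dN : is_derive x (1 : R) (-%R : R -> R) (-1) by exact: is_deriveNid.
have x0' : 0 < - x by rewrite oppr_gt0.
have H := @is_deriveN _ _ _ _ _ _ _ (is_derive1_comp (pos _ x0') dN).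
apply: (is_derive_eq H).
by rewrite mulrN1 opprK /= sqrrN.
Unshelve. all: by end_near. Qed.

Lemma is_derive_cbrt_comp (V : normedModType R) (F : V -> R) (x v : V) :
  F x != 0 -> differentiable F x ->
  is_derive x v (cbrt \o F) (3^-1 * (cbrt (F x)) ^- 2 * 'D_v F x)
  /\ differentiable (cbrt \o F) x.
Proof.
move=> F0 dF.
have dc : differentiable cbrt (F x).
  by apply/derivable1_diffP;
    exact: (@ex_derive _ _ _ _ _ _ _ (is_derive_cbrt F0)).
have dcF : differentiable (cbrt \o F) x by exact: differentiable_comp.
split=> //; apply: DeriveDef; first exact: diff_derivable.
rewrite deriveE// diff_comp//= deriveE// diff1E//.
rewrite derive1E (@derive_val _ _ _ _ _ _ _ (is_derive_cbrt F0)).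
by rewrite /GRing.scale /= mulrC.
Qed.

End CubeRoot.

(** * Jets of f in the normal order d_1^a d_3^b *)

Section Jets.
Context {R : realType} (U : set 'rV[R]_2) (f : 'rV[R]_2 -> R).
Hypotheses (openU : open U) (smoothf : smooth_on U f).

Definition jet (a b : nat) : 'rV[R]_2 -> R := iter a (pd 0) (iter b (pd 1) f).

Lemma jetE a b : jet a b = foldr pd f (nseq a 0 ++ nseq b 1).
Proof.
have iterE n i F : iter n (pd i) F = foldr (@pd R 2) F (nseq n i).
  by elim: n => //= n ->.
by rewrite foldr_cat /jet !iterE.
Qed.

Lemma jet_differentiable a b z : U z -> differentiable (jet a b) z.
Proof. by rewrite jetE; exact: smoothf. Qed.

Lemma near_open z : U z -> \forall y \near z, U y.
Proof. by move=> Uz; apply: open_nbhs_nbhs. Qed.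

(** Differentiation along x1 preserves the normal order by definition; along x3 the derivative is
    moved inwards past each d_1 by Schwarz. The inductive equality is differentiated, so it is
    needed near z and not only at z. *)
Lemma pd_jet a b z : U z -> pd 1 (jet a b) z = jet a b.+1 z.
Proof.
elim: a z => [//|a IHa] z Uz.
rewrite [LHS](@schwarz _ _ (jet a b)); first last.
- by rewrite jetE; exact: (smoothf (1 :: _)).
- exact: (jet_differentiable a.+1 b Uz).
- by near=> y; apply: jet_differentiable; near: y; exact: near_open.
apply: near_eq_derive; near=> y; apply: IHa; near: y; exact: near_open.
Unshelve. all: by end_near. Qed.

End Jets.

(** * Jet polynomials as functions on the domain in R^8 *)

Section Coordinates.
Context {R : realType} (U : set 'rV[R]_2) (f : 'rV[R]_2 -> R).
Hypotheses (openU : open U) (smoothf : smooth_on U f).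
Hypothesis f3_neq0 : forall z, U z -> f_3 f z != 0.

Definition ambient_domain : set 'rV[R]_8 :=
  [set u | 0 < coord_t u /\ U (x13 (base u))].

Definition kappa (u : 'rV[R]_8) : R := cbrt (f_3 f (x13 (base u))).

Definition coord (w : var) (u : 'rV[R]_8) : R :=
  match w with
  | (0%N, 0%N) => base u 0 0
  | (0%N, 1%N) => base u 0 1
  | (0%N, _) => coord_rho u
  | (a.+1, b) => jet f a b (x13 (base u))
  end.

Definition ev : jpoly -> 'rV[R]_8 -> R := peval (@coord_t R) kappa coord.

Lemma baseE (u : 'rV[R]_8) (k : 'I_6) : base u 0 k = u 0 (inord k.+1).
Proof.
rewrite !mxE; congr (u _ _); apply/val_inj => /=.
by rewrite inordK// ltnS (leq_trans (ltn_ord k)).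
Qed.

Lemma x13E (u : 'rV[R]_8) (k : 'I_2) :
  x13 (base u) 0 k = if k == 0 then u 0 1 else u 0 3.
Proof.
rewrite mxE; case: ifP => _; rewrite baseE; congr (u _ _); apply/val_inj => /=.
  by rewrite inordK.
by rewrite inordK.
Qed.

Lemma x13_base_affine (h : R) (v u : 'rV[R]_8) :
  x13 (base (h *: v + u)) = h *: x13 (base v) + x13 (base u).
Proof.
apply/rowP => k; rewrite [RHS]mxE [X in _ = X + _]mxE !x13E.
by case: ifP => _; rewrite !mxE.
Qed.

Lemma x13_base_delta (i : 'I_8) : x13 (base (delta_mx 0 i)) =
  if i == 1 then delta_mx 0 0 else if i == 3 then delta_mx 0 1 else 0 :> 'rV[R]_2.
Proof.
apply/rowP => k; rewrite x13E !mxE /=.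
case: i => -[|[|[|[|[|[|[|[|//]]]]]]]] ilt; case: k => -[|[|//]] klt;
  by rewrite !mxE.
Qed.

Lemma is_derive_entry (b i : 'I_8) (u : 'rV[R]_8) :
  is_derive u (delta_mx 0 i) (fun y => y 0 b) (i == b)%:R.
Proof.
have := @is_derive_affine _ _ _ _ (id : R -> R) (fun y : 'rV[R]_8 => y 0 b)
  u (delta_mx 0 i) (i == b)%:R.
rewrite derive_id; apply; last exact: derivable_id.
by move=> h; rewrite !mxE eq_sym.
Qed.

Lemma is_derive_x13_base (F : 'rV[R]_2 -> R) (i : 'I_8) (u : 'rV[R]_8) :
  differentiable F (x13 (base u)) ->
  is_derive u (delta_mx 0 i) (F \o (fun y => x13 (base y)))
    (if i == 1 then pd 0 F (x13 (base u))
     else if i == 3 then pd 1 F (x13 (base u)) else 0).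
Proof.
move=> dF.
have := @is_derive_affine _ _ _ _ F (fun y => x13 (base y)) u (delta_mx 0 i)
  (x13 (base (delta_mx 0 i))) (fun h => x13_base_affine h _ _)
    (diff_derivable dF).
rewrite x13_base_delta; case: ifP => // _; case: ifP => // _.
by rewrite derive0.
Qed.

Variable (u : 'rV[R]_8).
Hypothesis (domu : ambient_domain u).

Let t_neq0 : coord_t u != 0. Proof. by case: domu => /lt0r_neq0. Qed.
Let f3u : f_3 f (x13 (base u)) != 0. Proof. by case: domu => _ /f3_neq0. Qed.
Let k_neq0 : kappa u != 0. Proof. exact: cbrt_neq0. Qed.
Let k3 : kappa u ^+ 3 = coord (1, 1)%N u. Proof. exact: cbrt_exp3. Qed.

Lemma evD p q : ev (padd p q) u = ev p u + ev q u.
Proof. exact: pvalD. Qed.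
Lemma evB p q : ev (psub p q) u = ev p u - ev q u.
Proof. exact: pvalB. Qed.
Lemma evM p q : ev (pmul p q) u = ev p u * ev q u.
Proof. exact: pvalM. Qed.
Lemma evZ c p : ev (pscale c p) u = cval c * ev p u.
Proof. exact: pvalZ. Qed.
Lemma ev_sum n F : ev (psum n F) u = \sum_(i < n) ev (F i) u.
Proof. exact: pval_sum. Qed.
Lemma ev_nil : ev [::] u = 0.
Proof. exact: pval_nil. Qed.
Lemma ev_delta i j : ev (pdelta i j) u = (i == j)%:R.
Proof. exact: pval_delta. Qed.
Lemma ev_one : ev pone u = 1.
Proof. exact: pval_one. Qed.
Lemma ev_tk a b : ev (ptk a b) u = coord_t u ^ int_of_Z a * kappa u ^ int_of_Z b.
Proof. exact: pval_tk. Qed.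
Lemma ev_jet a b : ev (pjet a b) u = jet f a b (x13 (base u)).
Proof. exact: pval_jet. Qed.
Lemma ev_X1 : ev pX1 u = base u 0 0.
Proof. exact: (pval_var _ _ _ (0, 0)%N). Qed.
Lemma ev_X2 : ev pX2 u = base u 0 1.
Proof. exact: (pval_var _ _ _ (0, 1)%N). Qed.
Lemma ev_rho : ev prho u = coord_rho u.
Proof. exact: (pval_var _ _ _ (0, 2)%N). Qed.

Lemma x13_baseE : (fun y : 'rV[R]_8 => x13 (base y)) =
  (fun y => y 0 1 *: delta_mx 0 0 + y 0 3 *: delta_mx 0 1).
Proof.
apply/funext => y; apply/rowP => k.
rewrite x13E !mxE /=.
by case: k => -[|[|//]] klt /=; rewrite ?mulr1 ?mulr0 ?addr0 ?add0r.
Qed.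

Lemma differentiable_x13_base (F : 'rV[R]_2 -> R) :
  differentiable F (x13 (base u)) ->
  differentiable (F \o (fun y => x13 (base y))) u.
Proof.
move=> dF; apply: differentiable_comp => //.
rewrite x13_baseE; apply: differentiableD.
  by apply: differentiableZl; exact: differentiable_coord.
by apply: differentiableZl; exact: differentiable_coord.
Qed.

Let domU : U (x13 (base u)). Proof. by case: domu. Qed.

Lemma ev_differentiable p : differentiable (ev p) u.
Proof.
have dj a b := differentiable_x13_base (jet_differentiable smoothf a b domU).
apply: differentiable_peval => //.
- exact: differentiable_coord.
- exact: (@is_derive_cbrt_comp _ _ (fun y => f_3 f (x13 (base y))) u 0 f3u
    (dj 0%N 1%N)).2.
- move=> [[|a] b]; last exact: dj.
  case: b => [|[|b]]; last exact: differentiable_coord.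
    have -> : coord (0, 0)%N = (fun y => y 0 (inord 1)).
      by apply/funext => y; rewrite -(baseE y 0).
    exact: differentiable_coord.
  have -> : coord (0, 1)%N = (fun y => y 0 (inord 2)).
    by apply/funext => y; rewrite -(baseE y 1).
  exact: differentiable_coord.
Qed.

Lemma is_derive_jet a b (i : 'I_8) : is_derive u (delta_mx 0 i)
   (fun y => jet f a b (x13 (base y))) (ev (dvar i (a.+1, b)) u).
Proof.
apply: is_derive_eq;
  first exact: (is_derive_x13_base i (jet_differentiable smoothf a b domU)).
rewrite (pd_jet openU smoothf)//.
by case: i => -[|[|[|[|[|[|[|[|//]]]]]]]] ilt /=; rewrite ?ev_jet ?ev_nil.
Qed.

(** The symbolic derivation is correct once it is so on the symbols: t, k by the derivative of the
    cube root, the coordinates, and the jets by [pd_jet]. *)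
Lemma is_derive_ev (i : 'I_8) p :
  is_derive u (delta_mx 0 i) (ev p) (ev (pD i p) u).
Proof.
apply: is_derive_peval => //.
- apply: is_derive_eq; first exact: is_derive_entry.
  by case: i => -[|[|[|[|[|[|[|[|//]]]]]]]] ilt;
    rewrite /= -/(ev _ _) ?ev_one ?ev_nil.
- have [dk _] := @is_derive_cbrt_comp _ _ (fun y => f_3 f (x13 (base y))) u
    (delta_mx 0 i) f3u
    (differentiable_x13_base (jet_differentiable smoothf 0 1 domU)).
  apply: (is_derive_eq dk) => {dk}.
  rewrite (@derive_val _ _ _ _ _ _ _ (is_derive_jet 0 1 i)) -/(ev _ _).
  have c3 : cval (Zpos 2, 1%N) = 3^-1 :> R.
    by rewrite /cval -pmulrn expr1 (_ : Pos.to_nat 2 = 2%N)//; field.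
  case: i => -[|[|[|[|[|[|[|[|//]]]]]]]] ilt; rewrite /= ?ev_nil ?mulr0 ?evM //;
    by congr (_ * _);
      rewrite /ev /peval pval_term /mval /lval /= big_nil c3 expr0z mul1r mulr1.
- move=> [[|a] b]; last exact: is_derive_jet.
  have H (c : 'I_8) : is_derive u (delta_mx 0 i) (fun y => y 0 c) (i == c)%:R :=
    is_derive_entry c i u.
  case: b => [|[|b]].
  + have -> : coord (0, 0)%N = (fun y => y 0 (inord 1)).
      by apply/funext => y; rewrite -(baseE y 0).
    apply: (is_derive_eq (H _)) => {H}; rewrite -val_eqE /= inordK// -/(ev _ _).
    by case: i => -[|[|[|[|[|[|[|[|//]]]]]]]] ilt; rewrite /= ?ev_one ?ev_nil.
  + have -> : coord (0, 1)%N = (fun y => y 0 (inord 2)).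
      by apply/funext => y; rewrite -(baseE y 1).
    apply: (is_derive_eq (H _)) => {H}; rewrite -val_eqE /= inordK// -/(ev _ _).
    by case: i => -[|[|[|[|[|[|[|[|//]]]]]]]] ilt; rewrite /= ?ev_one ?ev_nil.
  + apply: (is_derive_eq (H _)) => {H}; rewrite -/(ev _ _).
    by case: i => -[|[|[|[|[|[|[|[|//]]]]]]]] ilt; rewrite /= ?ev_one ?ev_nil.
Qed.

Lemma pd_ev i p : pd i (ev p) u = ev (pD i p) u.
Proof. exact: (@derive_val _ _ _ _ _ _ _ (is_derive_ev i p)). Qed.
End Coordinates.

Lemma peqmxP n A B i j : peqmx n A B -> (i < n)%N -> (j < n)%N ->
  psub (A i j) (B i j) = [::].
Proof.
rewrite /peqmx => /seq.allP H ilt jlt.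
have {}H : all (fun j => pnil (psub (A i j) (B i j))) (iota 0 n).
  by apply: H; rewrite mem_iota.
have : pnil (psub (A i j) (B i j)) by apply: (seq.allP H); rewrite mem_iota.
by case: psub.
Qed.

(** * The ambient metric and its adapted frame *)

Section Geometry.
Context {R : realType} (U : set 'rV[R]_2) (f : 'rV[R]_2 -> R).
Hypotheses (openU : open U) (smoothf : smooth_on U f).
Hypothesis f3_neq0 : forall z, U z -> f_3 f z != 0.
Local Notation dom := (ambient_domain U).
Local Notation ev := (ev f).

Lemma ev_eqmx n A B u : dom u -> peqmx n A B ->
  forall i j : 'I_n, ev (A i j) u = ev (B i j) u.
Proof.
move=> du H i j; apply/eqP; rewrite -subr_eq0.
by rewrite -(evB f3_neq0 du) (peqmxP H)// ev_nil.
Qed.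

Section Pullback.
Variables (n s : nat) (e : 'rV[R]_n -> 'rV[R]_8).
Let O : set 'rV[R]_n := [set q | dom (e q)].
Hypothesis openO : open O.
Hypothesis pd_e : forall (i : 'I_n) p q, O q ->
  pd i (fun q => ev p (e q)) q = ev (pD (s + i) p) (e q).

(** Derivatives are local, so agreement on the open set suffices. The section is applied to a slice
    of R^8 with s = 1 and to the identity of R^8 with s = 0. *)
Lemma pd_pullback (i : 'I_n) F p q : (forall q, O q -> F q = ev p (e q)) ->
  O q -> pd i F q = ev (pD (s + i) p) (e q).
Proof.
move=> Fp Oq; rewrite -pd_e//; apply: near_eq_derive.
near=> y; apply: Fp; near: y; exact: open_nbhs_nbhs.
Unshelve. all: by end_near. Qed.

Variables (g : 'rV[R]_n -> 'M[R]_n) (G GI : pmx).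
Hypothesis gE : forall q, O q -> forall i j : 'I_n, g q i j = ev (G i j) (e q).
Hypothesis invgE : peqmx n (pmulmx n G GI) pdelta.

Lemma invmx_ev q (i j : 'I_n) : O q -> invmx (g q) i j = ev (GI i j) (e q).
Proof.
move=> Oq; pose h := \matrix_(i < n, j < n) ev (GI i j) (e q).
suff -> : invmx (g q) = h by rewrite mxE.
have gh : g q *m h = 1%:M.
  apply/matrixP => a b; rewrite !mxE -(ev_delta f (e q)).
  rewrite -(ev_eqmx Oq invgE) ev_sum.
  by apply: eq_bigr => k _; rewrite (evM f3_neq0 Oq) mxE gE.
by rewrite -[invmx _]mulmx1 -gh mulmxA mulVmx ?mul1mx// (mulmx1_unit gh).1.
Qed.

Lemma christoffel_ev q (k i j : 'I_n) : O q ->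
  christoffel g k i j q = ev (pchristoffel n s G GI k i j) (e q).
Proof.
move=> Oq; rewrite /christoffel /pchristoffel (evZ f3_neq0 Oq).
congr (_ * _).
  by rewrite /cval -pmulrn expr1 (_ : Pos.to_nat 3 = 3%N)//; field.
rewrite ev_sum; apply: eq_bigr => l _.
rewrite (evM f3_neq0 Oq) (evB f3_neq0 Oq) evD !memo3E//.
rewrite invmx_ev//.
by congr (_ * (_ + _ - _)); apply: pd_pullback => // y Oy; rewrite gE.
Qed.

(** The symbols are a parameter [C] so that the tabulated ones can be substituted. *)
Lemma ricci_ev (C : nat -> pmx) q (i j : 'I_n) : O q ->
  (forall q, O q -> forall k i j : 'I_n,
     christoffel g k i j q = ev (C k i j) (e q)) ->
  ricci g q i j = ev (pricci n s C i j) (e q).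
Proof.
move=> Oq CE; rewrite mxE /pricci ev_sum; apply: eq_bigr => k _.
rewrite evD (evB f3_neq0 Oq) ev_sum.
congr (_ - _ + _).
- by apply: pd_pullback => // y Oy; rewrite CE.
- by apply: pd_pullback => // y Oy; rewrite CE.
- apply: eq_bigr => l _.
  by rewrite (evB f3_neq0 Oq) !(evM f3_neq0 Oq) !CE.
Qed.

End Pullback.

Lemma open_ambient_domain : open dom.
Proof.
apply: openI.
  apply: (@open_comp _ _ (@coord_t R) [set x | 0 < x]); last exact: open_gt.
  by move=> x _; exact: coord_continuous.
apply: (@open_comp _ _ (fun u : 'rV[R]_8 => x13 (base u)) U) => // u _.
apply: differentiable_continuous; rewrite x13_baseE; apply: differentiableD.
  by apply: differentiableZl; exact: differentiable_coord.
by apply: differentiableZl; exact: differentiable_coord.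
Qed.

(* R^6 as the slice of R^8 with the given t and rho, so that one evaluation of jet
   polynomials serves both dimensions *)
Definition slice (t rho : R) (q : 'rV[R]_6) : 'rV[R]_8 :=
  row_mx t%:M (row_mx q rho%:M) : 'rV[R]_(1 + (6 + 1)).

Lemma base_slice t rho q : base (slice t rho q) = q.
Proof. by rewrite /base /slice row_mxKr row_mxKl. Qed.

Lemma coord_t_slice t rho q : coord_t (slice t rho q) = t.
Proof.
rewrite /coord_t /slice (_ : 0 = lshift (6 + 1) (0 : 'I_1)); last exact: val_inj.
by rewrite (@row_mxEl _ 1 1 (6 + 1)) mxE.
Qed.

Lemma coord_rho_slice t rho q : coord_rho (slice t rho q) = rho.
Proof.
rewrite /coord_rho /slice (_ : 7 = rshift 1 (rshift 6 (0 : 'I_1)));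
  last exact: val_inj.
by rewrite (@row_mxEr _ 1 1 (6 + 1)) row_mxEr mxE.
Qed.

Lemma slice_base u : slice (coord_t u) (coord_rho u) (base u) = u.
Proof.
rewrite /slice /base; set v : 'rV[R]_(1 + (6 + 1)) := u.
have -> : (coord_t u)%:M = lsubmx v.
  by apply/rowP => i; rewrite !mxE ord1; congr (u _ _); exact: val_inj.
have -> : (coord_rho u)%:M = rsubmx (rsubmx v).
  by apply/rowP => i; rewrite !mxE ord1; congr (u _ _); exact: val_inj.
by rewrite !hsubmxK.
Qed.

Lemma slice_affine (h t rho : R) (v q : 'rV[R]_6) :
  slice t rho (h *: v + q) = h *: slice 0 0 v + slice t rho q.
Proof.
have E n (x y : 'rV[R]_n) j : (h *: x + y) 0 j = h * x 0 j + y 0 j.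
  by rewrite !mxE.
rewrite -[RHS]slice_base; congr slice.
- by rewrite /coord_t E -!/(coord_t _) !coord_t_slice mulr0 add0r.
- by rewrite /coord_rho E -!/(coord_rho _) !coord_rho_slice mulr0 add0r.
- by apply/rowP => j; rewrite baseE !E -!baseE !base_slice.
Qed.

Lemma slice_delta (i : 'I_6) :
  slice 0 0 (delta_mx 0 i) = delta_mx 0 (inord i.+1).
Proof.
have lt8 : (i.+1 < 8)%N by rewrite ltnS (leq_trans (ltn_ord i)).
rewrite -[RHS]slice_base; congr slice.
- by rewrite /coord_t mxE eqxx /= -val_eqE /= inordK.
- rewrite /coord_rho mxE eqxx /= -val_eqE /= inordK//.
  by case: i lt8 => -[|[|[|[|[|[|//]]]]]].
- apply/rowP => j; rewrite baseE !mxE !eqxx /= -!val_eqE /= !inordK//.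
  by rewrite ltnS (leq_trans (ltn_ord _)).
Qed.

Lemma pd_slice t rho (i : 'I_6) p q : dom (slice t rho q) ->
  pd i (fun q => ev p (slice t rho q)) q = ev (pD (1 + i) p) (slice t rho q).
Proof.
move=> dq.
have lt8 : (i.+1 < 8)%N by rewrite ltnS (leq_trans (ltn_ord i)).
rewrite add1n -[in RHS](@inordK 7 i.+1)// -(pd_ev openU smoothf f3_neq0 dq).
rewrite /pd -slice_delta.
by apply: (@derive_affine _ _ _ _ (ev p)) => h; exact: slice_affine.
Qed.

Lemma open_slice t rho : open [set q | dom (slice t rho q)].
Proof.
rewrite (_ : [set q | _] = [set q | 0 < t] `&` (@x13 R) @^-1` U); last first.
  apply/funext => q; apply/propext; rewrite /ambient_domain /= base_slice.
  by rewrite coord_t_slice.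
apply: openI.
  case: (ltP 0 t) => t0.
    by rewrite (_ : [set _ | _] = setT); [exact: openT|apply/seteqP; split].
  by rewrite (_ : [set _ | _] = set0); [exact: open0|apply/seteqP; split].
apply: open_comp => // q _.
rewrite (_ : @x13 R =
  (fun q => q 0 0 *: delta_mx 0 0 + q 0 2 *: delta_mx 0 1)); last first.
  apply/funext => y; apply/rowP => k; rewrite !mxE /=.
  by case: k => -[|[|//]] klt /=; rewrite ?mulr1 ?mulr0 ?addr0 ?add0r.
apply: differentiable_continuous; apply: differentiableD.
  by apply: differentiableZl; exact: differentiable_coord.
by apply: differentiableZl; exact: differentiable_coord.
Qed.
End Geometry.

Lemma pbryantE i j : (i < 6)%N -> (j < 6)%N -> pbryant i j =
  padd (padd (ptwice pth1 pth4 i j) (ptwice pth2 pth5 i j))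
    (ptwice pth3 pth6 i j).
Proof. exact: memo2E. Qed.
Lemma pbryant_chrE k i j : (k < 6)%N -> (i < 6)%N -> (j < 6)%N ->
  pbryant_chr k i j = pchristoffel 6 1 pbryant pbryant_inv k i j.
Proof. exact: memo3E. Qed.
Lemma pbryant_ricciE i j : (i < 6)%N -> (j < 6)%N ->
  pbryant_ricci i j = pricci 6 1 pbryant_chr i j.
Proof. exact: memo2E. Qed.
Lemma pbryant_scalE : pbryant_scal =
  psum 6 (fun i => psum 6 (fun j => pmul (pbryant_inv i j) (pbryant_ricci i j))).
Proof. by []. Qed.
Lemma pbryant_scal_nil : pbryant_scal = [::].
Proof. by have := pbryant_scal_eq0; case: pbryant_scal. Qed.
Lemma pambientE i j : (i < 8)%N -> (j < 8)%N -> pambient i j =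
  match i, j with
  | 0, 0 => pscale (Zpos 2, 0) prho
  | 0, 7 | 7, 0 => ptk 1 0
  | i'.+1, j'.+1 => if (i' < 6) && (j' < 6) then
      pmul (ptk 2 0)
        (padd (pbryant i' j') (pmul prho (pscale c12 (pbryant_ricci i' j'))))
      else [::]
  | _, _ => [::]
  end%N.
Proof. exact: memo2E. Qed.
Lemma pambient_chrE k i j : (k < 8)%N -> (i < 8)%N -> (j < 8)%N ->
  pambient_chr k i j = pchristoffel 8 0 pambient pambient_inv k i j.
Proof. exact: memo3E. Qed.
Lemma pcoframeE i j : (i < 8)%N -> (j < 8)%N -> pcoframe i j =
  psum 8 (fun k => pmul (pframe k (shift4 i)) (pambient k j)).
Proof. exact: memo2E. Qed.
Lemma pconnectionE a i j : (i < 8)%N -> (j < 8)%N ->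
  pconnection a i j = pmulmx 8 (pconnection_left a) pframe i j.
Proof. exact: memo2E. Qed.
Lemma pconnection_leftE a i j : (i < 8)%N -> (j < 8)%N ->
  pconnection_left a i j =
  psub
    (psum 8 (fun l => pmul (pcoframe i l) (pambient_chr l a j)))
    (pD a (pcoframe i j)).
Proof. exact: memo2E. Qed.
(* unification would otherwise evaluate the tables *)
Opaque pbryant pbryant_inv pbryant_chr pbryant_ricci pbryant_scal.
Opaque pambient pambient_inv pambient_chr pframe pcoframe pconnection.

(** * Bryant's metric, its Schouten tensor and the ambient metric as evaluations *)

Section Metrics.
Context {R : realType} (U : set 'rV[R]_2) (f : 'rV[R]_2 -> R).
Hypotheses (openU : open U) (smoothf : smooth_on U f).
Hypothesis f3_neq0 : forall z, U z -> f_3 f z != 0.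
Local Notation dom := (ambient_domain U).
Local Notation ev := (ev f).

Lemma cvalE (n : positive) k : cval (Zpos n, k) = (Pos.to_nat n)%:R / 6 ^+ k :> R.
Proof. by rewrite /cval /= -pmulrn. Qed.

Lemma c12E : cval c12 = 1 / 2 :> R.
Proof. by rewrite cvalE expr1 (_ : Pos.to_nat 3 = 3%N)//; field. Qed.
Lemma c32E : cval c32 = 3 / 2 :> R.
Proof. by rewrite cvalE expr1 (_ : Pos.to_nat 9 = 9%N)//; field. Qed.
Lemma cval2 : cval (Zpos 2, 0%N) = 2 :> R.
Proof. by rewrite cvalE expr0 divr1. Qed.

Section At.
Variable u : 'rV[R]_8.
Hypothesis du : dom u.
Let z := x13 (base u).
Let k_neq0 : f_3 f z != 0. Proof. by case: du => _; exact: f3_neq0. Qed.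

Lemma ev_pF n : ev (ptk 0 (Z.of_nat (3 * n))) u = f_3 f z ^+ n.
Proof.
rewrite ev_tk expr0z mul1r (_ : int_of_Z _ = (3 * n)%N); last by lia.
by rewrite -exprnP exprM /kappa cbrt_exp3.
Qed.

Lemma f_33E : f_33 f z = ev (pjet 0 2) u.
Proof. by rewrite (ev_jet f3_neq0 du). Qed.
Lemma f_13E : f_13 f z = ev (pjet 1 1) u.
Proof. by rewrite (ev_jet f3_neq0 du). Qed.

Ltac ord6 j := case: j => -[|[|[|[|[|[|//]]]]]] ?.

Lemma theta1E (j : 'I_6) : theta1 (base u) 0 j = ev (pth1 j) u.
Proof.
rewrite !mxE !eqxx /=; ord6 j;
  by rewrite /pth1 /= ?ev_one ?ev_nil ?ev_X2 ?mulr0 ?mulr1 ?addr0 ?add0r ?mxE.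
Qed.
Lemma theta2E (j : 'I_6) : theta2 f (base u) 0 j = ev (pth2 j) u.
Proof.
rewrite !mxE !eqxx /=; ord6 j;
  by rewrite /pth2 /= ?ev_one ?ev_nil ?(ev_jet f3_neq0 du) ?mulr0 ?mulr1 ?addr0
    ?add0r ?mxE.
Qed.
Lemma theta3E (j : 'I_6) : theta3 (base u) 0 j = ev (pth3 j) u.
Proof.
rewrite !mxE !eqxx /=; ord6 j;
  by rewrite /pth3 /= ?ev_one ?ev_nil ?ev_X1 ?mulr0 ?mulr1 ?addr0 ?add0r ?mxE.
Qed.
Lemma theta4E (j : 'I_6) : theta4 f (base u) 0 j = ev (pth4 j) u.
Proof.
rewrite !mxE !eqxx /=; ord6 j;
  by rewrite /pth4 /= ?ev_nil ?(evZ f3_neq0 du) ?(ev_pF 2) ?c32E ?mulr0 ?mulr1.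
Qed.
Lemma theta5E (j : 'I_6) : theta5 f (base u) 0 j = ev (pth5 j) u.
Proof.
rewrite /pth5 (evB f3_neq0 du) (evM f3_neq0 du) (evZ f3_neq0 du) -theta1E -f_33E
  c12E.
rewrite /theta5 mxE; congr (_ + _); last by rewrite mxE [X in - X]mxE.
rewrite 2!mxE eqxx /=; ord6 j;
  by rewrite /= ?ev_nil ?(evZ f3_neq0 du) ?(ev_pF 1) ?c32E ?mulr0 ?mulr1.
Qed.
Lemma theta6E (j : 'I_6) : theta6 f (base u) 0 j = ev (pth6 j) u.
Proof.
rewrite /pth6 evD (evM f3_neq0 du) (evZ f3_neq0 du) -theta2E -f_13E c12E.
rewrite /theta6 mxE; congr (_ + _); last by rewrite mxE.
rewrite 2!mxE eqxx /=; ord6 j;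
  by rewrite /= ?ev_nil ?(evZ f3_neq0 du) ?(ev_pF 2) ?c32E ?mulr0 ?mulr1.
Qed.

Lemma twice_prodE (a b : 'rV[R]_6) pa pb :
  (forall j, a 0 j = ev (pa (nat_of_ord j)) u) ->
  (forall j, b 0 j = ev (pb (nat_of_ord j)) u) ->
  forall i j : 'I_6, twice_prod a b i j = ev (ptwice pa pb i j) u.
Proof.
move=> ha hb i j; rewrite mxE [X in X + _]mxE [X in _ + X]mxE !big_ord1.
by rewrite !(mxE _ _ _ 0) !ha !hb /ptwice evD !(evM f3_neq0 du).
Qed.

Lemma bryant_metricE (i j : 'I_6) :
  bryant_metric f (base u) i j = ev (pbryant i j) u.
Proof.
rewrite pbryantE// evD [X in _ = X + _]evD /bryant_metric mxE [X in X + _]mxE.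
congr (_ + _ + _).
- exact: (@twice_prodE _ _ pth1 pth4 theta1E theta4E i j).
- exact: (@twice_prodE _ _ pth2 pth5 theta2E theta5E i j).
- exact: (@twice_prodE _ _ pth3 pth6 theta3E theta6E i j).
Qed.
End At.

Lemma bryant_slice t rho q (i j : 'I_6) : dom (slice t rho q) ->
  bryant_metric f q i j = ev (pbryant i j) (slice t rho q).
Proof. by move=> dq; rewrite -bryant_metricE// base_slice. Qed.

Lemma christoffel6E t rho q (k i j : 'I_6) : dom (slice t rho q) ->
  christoffel (bryant_metric f) k i j q = ev (pbryant_chr k i j) (slice t rho q).
Proof.
move=> dq; rewrite pbryant_chrE//.
apply: (@christoffel_ev _ _ _ f3_neq0 6 1 (slice t rho)
  (@open_slice R U openU t rho) _
  (bryant_metric f)).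
- by move=> ? ? ? ?; exact: (pd_slice openU).
- by move=> y dy a b; exact: bryant_slice.
- exact: pbryant_invP.
- exact: dq.
Qed.

Lemma ricci6E t rho q (i j : 'I_6) : dom (slice t rho q) ->
  ricci (bryant_metric f) q i j = ev (pbryant_ricci i j) (slice t rho q).
Proof.
move=> dq; rewrite pbryant_ricciE//.
apply: (@ricci_ev _ _ _ f3_neq0 6 1 (slice t rho) (@open_slice R U openU t rho) _
  (bryant_metric f)).
- by move=> ? ? ? ?; exact: (pd_slice openU).
- exact: dq.
- by move=> y dy a b c; exact: christoffel6E.
Qed.

Lemma scalar_curvature6E t rho q : dom (slice t rho q) ->
  scalar_curvature (bryant_metric f) q = 0.
Proof.
move=> dq; transitivity (ev pbryant_scal (slice t rho q));
  last by rewrite pbryant_scal_nil ev_nil.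
rewrite pbryant_scalE ev_sum; apply: eq_bigr => i _.
rewrite ev_sum; apply: eq_bigr => j _; rewrite (evM f3_neq0 dq) -ricci6E//.
congr (_ * _).
apply: (@invmx_ev _ _ _ f3_neq0 6 (slice t rho) _ pbryant).
- by move=> y dy a b; exact: bryant_slice.
- exact: pbryant_invP.
- exact: dq.
Qed.

Lemma schouten6E u (i j : 'I_6) : dom u ->
  schouten6 (bryant_metric f) (base u) i j = 4^-1 * ev (pbryant_ricci i j) u.
Proof.
move=> du; have ds : dom (slice (coord_t u) (coord_rho u) (base u)).
  by rewrite slice_base.
rewrite mxE mxE [X in _ + X]mxE [X in - X]mxE (scalar_curvature6E ds).
by rewrite (ricci6E _ _ ds) slice_base mul0r mul0r subr0.
Qed.

Lemma ambient_metricE u (i j : 'I_8) : dom u ->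
  ambient_metric f u i j = ev (pambient i j) u.
Proof.
move=> du; rewrite pambientE// /ambient_metric.
pose m0 : 'I_(1 + (6 + 1)) := lshift (6 + 1) (0 : 'I_1).
pose m1 (k : 'I_6) : 'I_(1 + (6 + 1)) := rshift 1 (lshift 1 k).
pose m2 : 'I_(1 + (6 + 1)) := rshift 1 (rshift 6 (0 : 'I_1)).
have c8 (a : 'I_8) : [\/ a = m0, exists k, a = m1 k | a = m2].
  rewrite -(@splitK 1 (6 + 1) a); case: (@fintype.split 1 (6 + 1) a) => [b|b] /=.
    by rewrite [b]ord1; constructor 1.
  rewrite -(@splitK 6 1 b); case: (@fintype.split 6 1 b) => [k|k] /=.
    by constructor 2; exists k.
  by rewrite [k]ord1; constructor 3.
case: (c8 i) => [->|[k ->]|->]; case: (c8 j) => [->|[l ->]|->].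
- rewrite (@block_mxEul _ 1 (6 + 1) 1 (6 + 1)) mxE /= mulr1n.
  by rewrite (evZ f3_neq0 du) cval2 ev_rho.
- rewrite (@block_mxEur _ 1 (6 + 1) 1 (6 + 1)) row_mxEl mxE /=.
  by case: l => -[|[|[|[|[|[|//]]]]]] ? /=; rewrite ev_nil.
- rewrite (@block_mxEur _ 1 (6 + 1) 1 (6 + 1)) row_mxEr mxE /= mulr1n.
  by rewrite ev_tk mulr1.
- rewrite (@block_mxEdl _ 1 (6 + 1) 1 (6 + 1)) col_mxEu mxE /=.
  by case: k => -[|[|[|[|[|[|//]]]]]] ? /=; rewrite ev_nil.
- rewrite (@block_mxEdr _ 1 (6 + 1) 1 (6 + 1)) block_mxEul mxE /=.
  transitivity (ev (pmul (ptk 2 0) (padd (pbryant k l)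
     (pmul prho (pscale c12 (pbryant_ricci k l))))) u); last first.
    by case: k l => -[|[|[|[|[|[|//]]]]]] ? [l llt] /=; rewrite add0n llt.
  rewrite (evM f3_neq0 du) ev_tk evD (evM f3_neq0 du) (evZ f3_neq0 du) ev_rho.
  rewrite -bryant_metricE// mulr1 mxE [X in _ + X]mxE schouten6E// c12E.
  by congr (_ * (_ + _)); field.
- rewrite (@block_mxEdr _ 1 (6 + 1) 1 (6 + 1)) block_mxEur mxE /=.
  by case: k => -[|[|[|[|[|[|//]]]]]] ? /=; rewrite ev_nil.
- rewrite (@block_mxEdl _ 1 (6 + 1) 1 (6 + 1)) col_mxEd mxE /= mulr1n.
  by rewrite ev_tk mulr1.
- rewrite (@block_mxEdr _ 1 (6 + 1) 1 (6 + 1)) block_mxEdl mxE /=.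
  by case: l => -[|[|[|[|[|[|//]]]]]] ? /=; rewrite ev_nil.
- rewrite (@block_mxEdr _ 1 (6 + 1) 1 (6 + 1)) block_mxEdr mxE /=.
  by rewrite ev_nil.
Qed.
End Metrics.

(** * The adapted frame and its connection form *)

Section Frame.
Context {R : realType} (U : set 'rV[R]_2) (f : 'rV[R]_2 -> R).
Hypotheses (openU : open U) (smoothf : smooth_on U f).
Hypothesis f3_neq0 : forall z, U z -> f_3 f z != 0.
Local Notation dom := (ambient_domain U).
Local Notation ev := (ev f).

Definition frame (u : 'rV[R]_8) : 'M[R]_8 := \matrix_(i, j) ev (pframe i j) u.
Definition coframe (u : 'rV[R]_8) : 'M[R]_8 := \matrix_(i, j) ev (pcoframe i j) u.
Definition connection (a : 'I_8) (u : 'rV[R]_8) : 'M[R]_8 :=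
  \matrix_(i, j) ev (pconnection a i j) u.
Definition christoffel_mx (a : 'I_8) (u : 'rV[R]_8) : 'M[R]_8 :=
  \matrix_(k, b) christoffel (ambient_metric f) k a b u.

Lemma form44E (i j : 'I_8) : form44 i j = (shift4 i == j)%:R :> R.
Proof.
have c8 (a : 'I_8) : (exists k : 'I_4, a = lshift 4 k) \/
  (exists k : 'I_4, a = rshift 4 k).
  rewrite -(@splitK 4 4 a); case: (@fintype.split 4 4 a) => k /=.
    by left; exists k.
  by right; exists k.
rewrite /form44 /shift4; case: (c8 i) => -[k ->]; case: (c8 j) => -[l ->] /=.
- rewrite block_mxEul mxE ltn_ord; case: eqP => // e.
  by have := ltn_ord l; rewrite -e ltnNge leq_addl.
- by rewrite block_mxEur mxE ltn_ord addnC eqn_add2l.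
- by rewrite block_mxEdl mxE /= addKn.
- rewrite block_mxEdr mxE /= addKn; case: eqP => // e.
  by have := ltn_ord k; rewrite e ltnNge leq_addr.
Qed.

Lemma shift4_lt i : (i < 8)%N -> (shift4 i < 8)%N.
Proof. by rewrite /shift4; case: ifP; lia. Qed.

Section At.
Variable u : 'rV[R]_8.
Hypothesis du : dom u.

Lemma coframeK : coframe u *m frame u = 1%:M.
Proof.
apply/matrixP => i j; rewrite !mxE -(ev_delta f u).
rewrite -(ev_eqmx f3_neq0 du pframe_dual) /pmulmx ev_sum.
by apply: eq_bigr => k _; rewrite (evM f3_neq0 du) !mxE.
Qed.

Lemma coframeE : coframe u = form44 *m (frame u)^T *m ambient_metric f u.
Proof.
apply/matrixP => i j; rewrite mxE pcoframeE// ev_sum !mxE.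
apply: eq_bigr => k _; rewrite (evM f3_neq0 du) (ambient_metricE openU)//.
congr (_ * _); rewrite mxE (bigD1 (Ordinal (shift4_lt (ltn_ord i))))//=.
rewrite form44E eqxx mul1r !mxE big1 ?addr0// => l li.
by rewrite form44E -[shift4 i]/(val (Ordinal (shift4_lt (ltn_ord i)))) val_eqE
  eq_sym (negbTE li) mul0r.
Qed.

Lemma form44K : form44 *m form44 = 1%:M :> 'M[R]_8.
Proof.
rewrite /form44 mulmx_block !(mulmx0, mul0mx, mulmx1, add0r, addr0).
by rewrite -scalar_mx_block.
Qed.

(** The coframe is by construction F E^T g with F = [form44], so duality with the frame E is already
    orthonormality, up to the factor F. *)
Lemma frame_orthonormal : (frame u)^T *m ambient_metric f u *m frame u = form44.
Proof.
have := coframeK; rewrite coframeE => /(congr1 (mulmx form44)).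
by rewrite mulmx1 !mulmxA form44K mul1mx.
Qed.

Lemma christoffel8E (k i j : 'I_8) :
  christoffel (ambient_metric f) k i j u = ev (pambient_chr k i j) u.
Proof.
rewrite pambient_chrE//.
apply: (@christoffel_ev _ _ _ f3_neq0 8 0 id (@open_ambient_domain R U openU) _
  (ambient_metric f)).
- by move=> a p q dq; exact: (pd_ev openU).
- by move=> q dq a b; exact: (ambient_metricE openU).
- exact: pambient_invP.
- exact: du.
Qed.

(** The definition of the connection matrix solved for d_a E^-1, the form needed to differentiate
    the coframe along a curve. *)
Lemma pd_coframe (a i j : 'I_8) : pd a (fun u => coframe u i j) u =
  (coframe u *m christoffel_mx a u - connection a u *m coframe u) i j.
Proof.
pose D : 'M[R]_8 := \matrix_(i, j) pd a (fun u => coframe u i j) u.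
suff : connection a u = (coframe u *m christoffel_mx a u - D) *m frame u.
  move=> ->; rewrite -mulmxA (mulmx1C coframeK) mulmx1 opprB addrC subrK.
  by rewrite mxE.
apply/matrixP => b c; rewrite mxE pconnectionE// /pmulmx ev_sum [RHS]mxE.
apply: eq_bigr => k _; rewrite (evM f3_neq0 du) pconnection_leftE//.
rewrite (evB f3_neq0 du) [X in _ = _ * X]mxE; congr (_ * _).
rewrite [RHS]mxE ev_sum [X in _ = X + _]mxE [X in _ = _ + X]mxE
  [X in _ = _ - X]mxE.
congr (_ - _).
  apply: eq_bigr => l _; rewrite (evM f3_neq0 du) !mxE.
  by rewrite christoffel8E.
rewrite -(pd_ev openU smoothf f3_neq0 du).
by congr (pd _ _ _); apply/funext => v; rewrite mxE.
Qed.

End At.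
End Frame.

Opaque padd pmul psub pscale psum pD.

Lemma pnilP p : pnil p -> p = [::].
Proof. by case: p. Qed.

(** * Linear algebra of po(3,2) *)

Section LinearAlgebra.
Context {R : realType}.

Lemma J4_sqr : J4 *m J4 = - 1%:M :> 'M[R]_4.
Proof.
apply/matrixP => i j; rewrite !mxE !big_ord_recl big_ord0 !mxE.
by case: i => -[|[|[|[|//]]]] ?; case: j => -[|[|[|[|//]]]] ? /=;
  rewrite ?(mulr0, mul0r, mulr1, mul1r, mulrN1, addr0, add0r, oppr0, opprK,
    mulN1r).
Qed.

(** Both are multiples of Z_03 + Z_12. The trace is the version that fits into products of matrices
    and can be differentiated along them. *)
Lemma wedge_form_J4 (Z : 'M[R]_4) : Defs.skew Z ->
  wedge_form Z J4 = 0 <-> \tr (J4 *m Z) = 0.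
Proof.
move=> skZ; have hs i j : Z i j = - Z j i.
  by have := congr1 (fun m : 'M[R]_4 => m j i) skZ; rewrite !mxE.
have tr2 : \tr (J4 *m Z) = - 2 * wedge_form Z J4.
  rewrite /mxtrace /wedge_form !mxE !big_ord_recl !big_ord0 !mxE.
  rewrite !big_ord_recl !big_ord0 !mxE /=.
  rewrite (_ : lift ord0 (lift ord0 (lift ord0 ord0)) = 3); last exact: val_inj.
  rewrite (_ : lift ord0 (lift ord0 ord0) = 2); last exact: val_inj.
  rewrite (_ : lift ord0 ord0 = 1); last exact: val_inj.
  rewrite (_ : ord0 = 0); last exact: val_inj.
  by rewrite (hs 3 0) (hs 2 1); ring.
rewrite tr2; split=> [->|/eqP]; first by rewrite mulr0.
by rewrite mulf_eq0 oppr_eq0 pnatr_eq0 /= => /eqP.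
Qed.

(** J conjugates X into its negative transpose. *)
Lemma sp_trace (X : 'M[R]_4) : X *m J4 + J4 *m X^T = 0 -> \tr X = 0.
Proof.
move=> /eqP; rewrite addr_eq0 => /eqP XJ.
have XE : X = J4 *m X^T *m J4.
  rewrite -[LHS]mulmx1 -[1%:M]opprK -J4_sqr mulmxN mulmxA XJ.
  by rewrite mulNmx opprK.
have : \tr X = - \tr X.
  rewrite {1}XE mxtrace_mulC mulmxA J4_sqr mulNmx mul1mx.
  by rewrite linearN /= mxtrace_tr.
by move/eqP; rewrite -subr_eq0 opprK -mulr2n mulrn_eq0 => /eqP.
Qed.

Lemma mem_po32 (A : 'M[R]_(4 + 4)) :
  dlsubmx A = 0 -> drsubmx A = - (ulsubmx A)^T -> Defs.skew (ursubmx A) ->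
  ulsubmx A *m J4 + J4 *m (ulsubmx A)^T = 0 ->
  wedge_form (ursubmx A) J4 = 0 -> po32 A.
Proof.
move=> A21 A22 skA spA wA; exists (ulsubmx A), (ursubmx A); split=> //.
  by rewrite /po33_mx -A21 -A22 submxK.
exact: sp_trace.
Qed.

End LinearAlgebra.

Section Connection.
Context {R : realType} (U : set 'rV[R]_2) (f : 'rV[R]_2 -> R).
Hypotheses (openU : open U) (smoothf : smooth_on U f).
Hypothesis f3_neq0 : forall z, U z -> f_3 f z != 0.
Local Notation dom := (ambient_domain U).
Local Notation ev := (ev f).
Variable u : 'rV[R]_8.
Hypothesis du : dom u.

Lemma ev_J4 (i j : 'I_4) : ev (pJ4 i j) u = J4 i j.
Proof.
rewrite mxE /pJ4; case: Nat.eqb_spec => [->|/eqP/negbTE ->]; last exact: ev_nil.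
rewrite eqxx /ev /peval pval_const /cval /=.
by case: i => -[|[|[|[|//]]]] ? /=; rewrite ?expr0 ?divr1 // mulrN1z.
Qed.

Lemma ev_mx n (A B : pmx) (C : 'M[R]_n) :
  (forall i j : 'I_n, ev (B i j) u = C i j) ->
  peqmx n A B -> \matrix_(i < n, j < n) ev (A i j) u = C.
Proof.
move=> BC AB; apply/matrixP => i j.
by rewrite mxE (ev_eqmx f3_neq0 du AB).
Qed.

Lemma ev_pmulmx n (A B : pmx) : \matrix_(i < n, j < n) ev (pmulmx n A B i j) u =
  (\matrix_(i < n, j < n) ev (A i j) u) *m (\matrix_(i < n, j < n) ev (B i j) u).
Proof.
apply/matrixP => i j; rewrite !mxE ev_sum; apply: eq_bigr => k _.
by rewrite (evM f3_neq0 du) !mxE.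
Qed.

Lemma ev_pwedge (s x : pmx) : ev (pwedge s x) u =
  wedge_form (\matrix_(i < 4, j < 4) ev (s i j) u)
             (\matrix_(i < 4, j < 4) ev (x i j) u).
Proof.
rewrite /pwedge /wedge_form !mxE.
by rewrite evD (evB f3_neq0 du) 2!evD (evB f3_neq0 du) !(evM f3_neq0 du).
Qed.

Lemma connection_po32 (a : 'I_8) : po32 (connection f a u).
Proof.
have : ppo32 (pconnection a).
  by apply: (seq.allP pconnection_po32); rewrite mem_iota /=.
rewrite /ppo32 => /and5P[h1 h2 h3 h4 h5].
pose A := connection f a u : 'M[R]_(4 + 4).
have ul : ulsubmx A = \matrix_(i < 4, j < 4) ev (pconnection a i j) u.
  by apply/matrixP => i j; rewrite !mxE.
have ur : ursubmx A = \matrix_(i < 4, j < 4) ev (pconnection a i (4 + j)%N) u.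
  by apply/matrixP => i j; rewrite !mxE.
have Jm : J4 = \matrix_(i < 4, j < 4) ev (pJ4 i j) u.
  by apply/matrixP => i j; rewrite mxE ev_J4.
apply: (@mem_po32 _ A).
- transitivity (\matrix_(i < 4, j < 4) ev (pconnection a (4 + i)%N j) u).
    by apply/matrixP => i j; rewrite !mxE.
  by apply: ev_mx h1 => i j; rewrite ev_nil mxE.
- transitivity (\matrix_(i < 4, j < 4) ev (pconnection a (4 + i)%N (4 + j)%N) u).
    by apply/matrixP => i j; rewrite !mxE.
  by apply: ev_mx h2 => i j; rewrite (evB f3_neq0 du) ev_nil ul !mxE sub0r.
- rewrite /Defs.skew ur.
  transitivity (\matrix_(i < 4, j < 4) ev (pconnection a j (4 + i)%N) u).
    by apply/matrixP => i j; rewrite !mxE.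
  by apply: ev_mx h3 => i j; rewrite (evB f3_neq0 du) ev_nil !mxE sub0r.
- apply/eqP; rewrite addr_eq0; apply/eqP; rewrite ul Jm -ev_pmulmx.
  apply: ev_mx h4 => i j.
  rewrite (evB f3_neq0 du) ev_nil sub0r mxE; congr (- _).
  have -> : (\matrix_(i < 4, j < 4) ev (pconnection a i j) u)^T =
    \matrix_(i < 4, j < 4) ev (ptr (pconnection a) i j) u.
    by apply/matrixP => k l; rewrite !mxE.
  by rewrite -ev_pmulmx mxE.
- have -> : wedge_form (ursubmx A) J4 =
      ev (pwedge (fun i j => pconnection a i (4 + j)%N) pJ4) u.
    rewrite ev_pwedge ur; congr wedge_form.
    by apply/matrixP => i j; rewrite mxE ev_J4.
  exact: etrans (congr1 (ev ^~ u) (pnilP h5)) (ev_nil _ _).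
Qed.

End Connection.

(** * Parallel transport *)

Section MatrixCurves.
Context {R : realType}.

Definition mx_derive m n (F : R -> 'M[R]_(m, n)) (s : R) (dF : 'M[R]_(m, n)) :=
  forall i j, is_derive s 1 (fun s => F s i j) (dF i j).

Definition mx_continuous m n (F : R -> 'M[R]_(m, n)) :=
  forall i j, {within `[0, 1], continuous (fun s => F s i j)}.

Lemma mx_derive_cst m n (A : 'M[R]_(m, n)) s : mx_derive (fun=> A) s 0.
Proof. by move=> i j; rewrite mxE; exact: is_derive_cst. Qed.

Lemma mx_derive_tr m n (F : R -> 'M[R]_(m, n)) s dF : mx_derive F s dF ->
  mx_derive (fun s => (F s)^T) s dF^T.
Proof.
move=> dFs i j; rewrite mxE.
by rewrite (_ : (fun _ => _) = (fun s => F s j i)) //; apply/funext => u;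
  rewrite mxE.
Qed.

Lemma is_derive_fct_sum n (h : 'I_n -> R -> R) (s : R) (dh : 'I_n -> R) :
  (forall i, is_derive s 1 (h i) (dh i)) ->
  is_derive s 1 (fun x => \sum_(i < n) h i x) (\sum_(i < n) dh i).
Proof.
move=> H; rewrite (_ : (fun _ => _) = \sum_(i < n) h i).
  exact: is_derive_sum.
by apply/funext => x; rewrite fct_sumE.
Qed.

Lemma mx_derive_mul m n p (F : R -> 'M[R]_(m, n)) (G : R -> 'M[R]_(n, p))
    s dF dG :
  mx_derive F s dF -> mx_derive G s dG ->
  mx_derive (fun s => F s *m G s) s (dF *m G s + F s *m dG).
Proof.
move=> dFs dGs i j.
rewrite (_ : (fun _ => _) = (fun s => \sum_k F s i k * G s k j)); last first.
  by apply/funext => u; rewrite mxE.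
rewrite !mxE -big_split /=; apply: is_derive_fct_sum => k.
apply: (is_derive_eq (is_derive_fctM (dFs i k) (dGs k j))).
by rewrite addrC [G s k j * _]mulrC.
Qed.

(** The trace is packed as a 1 by 1 matrix so that the constancy and uniqueness results for matrix
    curves apply to it. *)
Lemma mx_derive_trace n (F : R -> 'M[R]_n) s dF : mx_derive F s dF ->
  mx_derive (fun s => (\tr (F s))%:M : 'M[R]_1) s (\tr dF)%:M.
Proof.
move=> dFs i j; rewrite !ord1 mxE mulr1n.
rewrite (_ : (fun _ => _) = (fun s => \sum_k F s k k)); last first.
  by apply/funext => u; rewrite mxE mulr1n.
exact: is_derive_fct_sum.
Qed.

Lemma mx_derive_unique m n (F : R -> 'M[R]_(m, n)) s dF dF' :
  mx_derive F s dF -> mx_derive F s dF' -> dF = dF'.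
Proof.
move=> H H'; apply/matrixP => i j.
by rewrite -(@derive_val _ _ _ _ _ _ _ (H i j))
  (@derive_val _ _ _ _ _ _ _ (H' i j)).
Qed.

Lemma mx_continuous_cst m n (A : 'M[R]_(m, n)) : mx_continuous (fun=> A).
Proof. by move=> i j; exact: cst_continuous. Qed.

Lemma mx_continuous_tr m n (F : R -> 'M[R]_(m, n)) : mx_continuous F ->
  mx_continuous (fun s => (F s)^T).
Proof.
move=> cF i j; rewrite (_ : (fun _ => _) = (fun s => F s j i)) //.
by apply/funext => u; rewrite mxE.
Qed.

Lemma within_continuous_sum n (h : 'I_n -> R -> R) :
  (forall i, {within `[0, 1], continuous (h i)}) ->
  {within `[0, 1], continuous (fun x => \sum_(i < n) h i x)}.
Proof.
move=> H; rewrite (_ : (fun _ => _) = \sum_(i < n) h i); last first.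
  by apply/funext => x; rewrite fct_sumE.
apply: (big_ind (fun g : R -> R => {within `[0, 1], continuous g})) => //.
  exact: cst_continuous.
by move=> g g' cg cg' x; apply: continuousD; [exact: cg|exact: cg'].
Qed.

Lemma mx_continuous_mul m n p (F : R -> 'M[R]_(m, n)) (G : R -> 'M[R]_(n, p)) :
  mx_continuous F -> mx_continuous G -> mx_continuous (fun s => F s *m G s).
Proof.
move=> cF cG i j.
rewrite (_ : (fun _ => _) = (fun s => \sum_k F s i k * G s k j)); last first.
  by apply/funext => u; rewrite mxE.
apply: within_continuous_sum => k x.
exact: (cvgM (cF i k x) (cG k j x)).
Qed.

Lemma mx_continuous_trace n (F : R -> 'M[R]_n) : mx_continuous F ->
  mx_continuous (fun s => (\tr (F s))%:M : 'M[R]_1).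
Proof.
move=> cF i j.
rewrite (_ : (fun _ => _) = (fun s => \sum_k F s k k)); last first.
  by apply/funext => u; rewrite !ord1 mxE mulr1n.
by apply: within_continuous_sum => k; exact: cF.
Qed.

(** The mean value theorem, entry by entry. A parallel frame is differentiable only inside (0, 1),
    so continuity on the closed interval carries the result to the endpoints. *)
Lemma mx_derive0_cst m n (F : R -> 'M[R]_(m, n)) : mx_continuous F ->
  (forall s, 0 < s < 1 -> mx_derive F s 0) ->
  forall s, 0 <= s <= 1 -> F s = F 0.
Proof.
move=> cF dF s /andP[s0 s1]; apply/matrixP => i j.
have [|x xs||c _] := @MVT_segment R (fun s => F s i j) (fun=> 0) 0 s.
- exact: s0.
- have := dF x; rewrite in_itv /= in xs; case/andP: xs => x0 xs.
  by rewrite x0 (lt_le_trans xs s1) => /(_ isT i j); rewrite mxE.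
- apply: continuous_subspaceW (cF i j) => x;
    rewrite /= !in_itv /= => /andP[-> xs].
  exact: le_trans xs s1.
- by rewrite mul0r => /eqP; rewrite subr_eq0 => /eqP.
Qed.

End MatrixCurves.

(** * An algebraic group with Lie algebra po(3,2) *)

Section Group.
Context {R : realType}.

(** The symplectic form of the quotient of R^8 by the invariant null 4-plane, pulled back to R^8;
    the 4-plane is its kernel. *)
Definition symp_form : 'M[R]_(4 + 4) := block_mx 0 0 0 J4.
Definition symp_proj : 'M[R]_(4 + 4) := block_mx J4 0 0 0.
Definition shift_mx : 'M[R]_(4 + 4) := block_mx 0 0 1%:M 0.

(* For V = [[a, b], [0, d]] the third condition says that the skew matrix b a^T is
   orthogonal to J. *)
Definition PO32 (V : 'M[R]_(4 + 4)) : Prop :=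
  [/\ V^T *m form44 *m V = form44, V^T *m symp_form *m V = symp_form
    & \tr (symp_proj *m (V *m shift_mx *m V^T)) = 0].

(** With blocks a, b, c, d, the equation d^T J d = J makes d^T J invertible, and then d^T J c = 0
    gives c = 0: preserving a degenerate form means preserving its kernel. The other form then gives
    a^T d = 1. *)
Lemma PO32_blocks (V : 'M[R]_(4 + 4)) : V^T *m form44 *m V = form44 ->
  V^T *m symp_form *m V = symp_form ->
  dlsubmx V = 0 /\ drsubmx V *m (ulsubmx V)^T = 1%:M.
Proof.
move: (ulsubmx V) (ursubmx V) (dlsubmx V) (drsubmx V) (submxK V) => a b c d <-.
rewrite /form44 /symp_form tr_block_mx !mulmx_block.
rewrite !(mulmx0, mul0mx, mulmx1, add0r, addr0).
move=> /eq_block_mx[_ h12 _ _] /eq_block_mx[_ _ c21 c22].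
have c22' : (d^T *m J4) *m (- d *m J4) = 1%:M.
  by rewrite mulmxA mulmxN c22 mulNmx J4_sqr opprK.
have c0 : c = 0.
  have dJU : d^T *m J4 \in unitmx by case/mulmx1_unit: c22' .
  by rewrite -[c](mulKmx dJU) c21 mulmx0.
split=> //; apply: mulmx1C.
by move: h12; rewrite c0 trmx0 mul0mx add0r.
Qed.

Lemma po32_form44 (A : 'M[R]_(4 + 4)) : po32 A -> A^T *m form44 + form44 *m A = 0.
Proof.
move=> [X [Z [-> _ skZ _ _]]].
rewrite /form44 /po33_mx tr_block_mx !mulmx_block.
rewrite !(mulmx0, mul0mx, mulmx1, mul1mx, add0r, addr0, trmx0) add_block_mx.
by rewrite skZ linearN /= trmxK !addNr !addrN addr0 -block_mx0.
Qed.

Lemma sp_tr (X : 'M[R]_4) : X *m J4 + J4 *m X^T = 0 -> J4 *m X + X^T *m J4 = 0.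
Proof.
move=> XJ; have : J4 *m (X *m J4 + J4 *m X^T) *m J4 = 0.
  by rewrite XJ mulmx0 mul0mx.
rewrite mulmxDr mulmxDl (mulmxA J4 J4) J4_sqr -!mulmxA J4_sqr.
rewrite !(mulmxN, mulNmx) mulmx1 !mul1mx -opprD => /eqP.
by rewrite oppr_eq0 => /eqP.
Qed.

Lemma po32_symp (A : 'M[R]_(4 + 4)) : po32 A ->
  A^T *m symp_form + symp_form *m A = 0.
Proof.
move=> [X [Z [-> _ _ XJ _]]].
rewrite /symp_form /po33_mx tr_block_mx !mulmx_block.
rewrite !(mulmx0, mul0mx, mulmx1, mul1mx, add0r, addr0, trmx0) add_block_mx.
by rewrite linearN /= trmxK mulNmx mulmxN -opprD XJ oppr0 !addr0 -block_mx0.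
Qed.

(** Up to sign this is the derivative of the third expression of [PO32] along V' = - A V. The
    symplectic condition removes the diagonal block, and d a^T = 1 reduces the rest to the trace of
    J Z. *)
Lemma po32_trace (A V : 'M[R]_(4 + 4)) : po32 A ->
  dlsubmx V = 0 -> drsubmx V *m (ulsubmx V)^T = 1%:M ->
  \tr ((symp_proj *m A + A^T *m symp_proj) *m (V *m shift_mx *m V^T)) = 0.
Proof.
move=> [X [Z [-> _ skZ XJ wZ]]] V21 V22.
rewrite -[V]submxK V21; set a := ulsubmx V; set b := ursubmx V.
set d := drsubmx V.
rewrite /symp_proj /shift_mx /po33_mx !tr_block_mx !mulmx_block.
rewrite !(mulmx0, mul0mx, mulmx1, mul1mx, add0r, addr0, trmx0) add_block_mx.
rewrite sp_tr// !mulmx_block.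
rewrite !(mulmx0, mul0mx, mulmx1, mul1mx, add0r, addr0, trmx0).
rewrite mxtrace_block mxtrace0 addr0 V22 mulmx1.
exact/wedge_form_J4.
Qed.

Lemma po32_0 : po32 (0 : 'M[R]_(4 + 4)).
Proof.
exists 0, 0; split; rewrite ?mxtrace0 ?mul0mx ?trmx0 ?mulmx0 ?addr0//.
- by rewrite /po33_mx trmx0 oppr0 block_mx0.
- by rewrite /Defs.skew trmx0 oppr0.
- by rewrite /wedge_form !mxE; ring.
Qed.

Lemma po32_lin (x : R) (A B : 'M[R]_(4 + 4)) : po32 A -> po32 B ->
  po32 (x *: A + B).
Proof.
move=> [X [Z [-> tX sZ sX wZ]]] [Y [W [-> tY sW sY wW]]].
exists (x *: X + Y), (x *: Z + W); split.
- rewrite /po33_mx scale_block_mx add_block_mx scaler0 addr0.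
  by rewrite linearD linearZ /= opprD scalerN.
- by rewrite linearD linearZ /= tX tY mulr0 addr0.
- by rewrite /Defs.skew linearD linearZ /= sZ sW opprD scalerN.
- rewrite mulmxDl linearD linearZ /= mulmxDr -scalemxAl -scalemxAr addrACA.
  by rewrite -scalerDr sX sY scaler0 addr0.
- have -> : wedge_form (x *: Z + W) J4 = x * wedge_form Z J4 + wedge_form W J4.
    by rewrite /wedge_form !mxE; ring.
  by rewrite wZ wW mulr0 addr0.
Qed.

Lemma po32_comb n (x : 'I_n -> R) (A : 'I_n -> 'M[R]_(4 + 4)) :
  (forall i, po32 (A i)) -> po32 (\sum_i x i *: A i).
Proof.
move=> H; apply: (big_ind (@po32 R)); first exact: po32_0.
- by move=> B C pB pC; rewrite -[B]scale1r; exact: po32_lin.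
- by move=> i _; rewrite -[_ *: _]addr0; apply: po32_lin => //; exact: po32_0.
Qed.

End Group.

Section Curves.
Context {R : realType}.

Lemma smooth_curve_derivable n (c : R -> 'rV[R]_n) s : smooth_curve c ->
  derivable c s 1.
Proof.
by move=> sc; apply/derivable_mxP => i j; rewrite ord1; exact: (sc j 0%N).
Qed.

Lemma is_derive_along_curve n (c : R -> 'rV[R]_n) (F : 'rV[R]_n -> R) (s : R) :
  smooth_curve c -> differentiable F (c s) ->
  is_derive s 1 (F \o c)
    (\sum_(a < n) derive1 (fun u => c u 0 a) s * pd a F (c s)).
Proof.
move=> sc dF; have dc : derivable c s 1 by exact: smooth_curve_derivable.
have dc' : differentiable c s by apply/derivable1_diffP.
have dFc : differentiable (F \o c) s by exact: differentiable_comp.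
apply: DeriveDef; first exact: diff_derivable.
have dcE : 'd c s 1 = 'D_1 c s by rewrite deriveE.
rewrite deriveE// diff_comp//= dcE derive_mx// [X in 'd F (c s) X]row_sum_delta
  linear_sum /=.
apply: eq_bigr => a _; rewrite linearZ /= mxE derive1E.
by rewrite /pd [X in _ = _ * X]deriveE.
Qed.

End Curves.

(** * First integrals of the parallel transport along one curve *)

Section Transport.
Context {R : realType} (U : set 'rV[R]_2) (f : 'rV[R]_2 -> R).
Hypotheses (openU : open U) (smoothf : smooth_on U f).
Hypothesis f3_neq0 : forall z, U z -> f_3 f z != 0.
Local Notation dom := (ambient_domain U).
Variables (c : R -> 'rV[R]_8) (W : R -> 'M[R]_8).
Hypotheses (smoothc : smooth_curve c)
  (cdom : forall s : R, 0 <= s <= 1 -> dom (c s))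
  (parW : parallel_frame (ambient_metric f) c W).

Definition velocity (s : R) (a : 'I_8) : R := derive1 (fun u => c u 0 a) s.
Definition connection_along (s : R) : 'M[R]_8 :=
  \sum_a velocity s a *: connection f a (c s).
Definition christoffel_along (s : R) : 'M[R]_8 :=
  \sum_a velocity s a *: christoffel_mx f a (c s).

Lemma connection_along_po32 s : 0 <= s <= 1 -> po32 (connection_along s).
Proof.
move=> hs; apply: po32_comb => a.
by apply: (connection_po32 f3_neq0); exact: cdom.
Qed.

Lemma differentiable_coframe u i j : dom u ->
  differentiable (fun v => coframe f v i j) u.
Proof.
move=> du; rewrite (_ : (fun _ => _) = ev f (pcoframe i j)).
  exact: (ev_differentiable smoothf f3_neq0 du).
by apply/funext => v; rewrite mxE.
Qed.

Lemma coframe_derive s : 0 <= s <= 1 -> mx_derive (fun s => coframe f (c s)) s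
  (coframe f (c s) *m christoffel_along s
   - connection_along s *m coframe f (c s)).
Proof.
move=> hs i j; have du := cdom hs.
apply: (is_derive_eq
  (is_derive_along_curve smoothc (differentiable_coframe i j du))).
rewrite /christoffel_along /connection_along mulmx_sumr mulmx_suml -sumrB summxE.
apply: eq_bigr => a _; rewrite (pd_coframe openU smoothf f3_neq0 du).
by rewrite -scalemxAl -scalemxAr -scalerBr [RHS]mxE.
Qed.

Lemma coframe_continuous : mx_continuous (fun s => coframe f (c s)).
Proof.
move=> i j; apply/subspace_continuousP => s /= hs.
apply: cvg_within_filter.
have : differentiable ((fun v => coframe f v i j) \o c) s.
  apply: differentiable_comp.
    by apply/derivable1_diffP; exact: smooth_curve_derivable.
  by apply: differentiable_coframe; apply: cdom; move: hs; rewrite in_itv.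
by move/differentiable_continuous.
Qed.

Lemma frame_derive s : 0 < s < 1 -> mx_derive W s (- christoffel_along s *m W s).
Proof.
move=> hs k j; case: parW => _ _ /(_ k j s hs) dW; apply: (is_derive_eq dW).
rewrite mulNmx mxE /christoffel_along mulmx_suml summxE; congr (- _).
apply: eq_bigr => a _; rewrite -scalemxAl mxE mxE mulr_sumr.
by apply: eq_bigr => b _; rewrite mxE mulrA [velocity s a * _]mulrC.
Qed.

Variable Y : 'M[R]_8.
(* a parallel frame expressed in the adapted frame *)
Definition moving (s : R) : 'M[R]_(4 + 4) := coframe f (c s) *m W s *m Y.

(** The Christoffel terms in the derivatives of the coframe and of the parallel frame cancel. *)
Lemma moving_derive s : 0 < s < 1 ->
  mx_derive moving s (- connection_along s *m moving s).
Proof.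
move=> hs; have hs' : 0 <= s <= 1 by case/andP: hs => /ltW -> /ltW ->.
have := mx_derive_mul (mx_derive_mul (coframe_derive hs') (frame_derive hs))
  (mx_derive_cst Y s).
rewrite mulmx0 addr0 mulmxBl mulNmx mulmxN !mulmxA addrAC subrr add0r.
by rewrite !mulNmx /moving.
Qed.

Lemma moving_continuous : mx_continuous moving.
Proof.
apply: mx_continuous_mul; last exact: mx_continuous_cst.
apply: mx_continuous_mul; first exact: coframe_continuous.
by case: parW.
Qed.

(** Along V' = - A V the derivative of V^T Q V is - V^T (A^T Q + Q A) V. *)
Lemma quadratic_invariant (Q : 'M[R]_(4 + 4)) :
  (forall A, po32 A -> A^T *m Q + Q *m A = 0) ->
  forall s, 0 <= s <= 1 ->
  (moving s)^T *m Q *m moving s = (moving 0)^T *m Q *m moving 0.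
Proof.
move=> HQ; apply:
  (@mx_derive0_cst _ _ _ (fun s => (moving s)^T *m Q *m moving s)).
  apply: mx_continuous_mul moving_continuous.
  apply: mx_continuous_mul; last exact: mx_continuous_cst.
  exact: mx_continuous_tr moving_continuous.
move=> s hs; have dm := moving_derive hs.
have := mx_derive_mul (mx_derive_mul (mx_derive_tr dm) (mx_derive_cst Q s)) dm.
have hs' : 0 <= s <= 1 by case/andP: hs => /ltW -> /ltW ->.
have := HQ _ (connection_along_po32 hs'); set A := connection_along s => e.
rewrite mulmx0 addr0 trmx_mul linearN /= mulNmx mulmxN !mulmxN !mulNmx -opprD.
rewrite -!mulmxA -mulmxDr [X in _ *m (X + _)]mulmxA [X in _ *m (_ + X)]mulmxA.
by rewrite -mulmxDl e mul0mx mulmx0 oppr0.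
Qed.

Lemma moving_PO32 : PO32 (moving 0) -> PO32 (moving 1).
Proof.
move=> [h0 s0 t0].
have h1 s (hs : 0 <= s <= 1) :=
  etrans (quadratic_invariant (@po32_form44 R) hs) h0.
have s1 s (hs : 0 <= s <= 1) :=
  etrans (quadratic_invariant (@po32_symp R) hs) s0.
have in1 : 0 <= (1 : R) <= 1 by rewrite ler01 lexx.
split; [exact: h1|exact: s1|].
pose F s : 'M[R]_1 :=
  (\tr (symp_proj *m (moving s *m shift_mx *m (moving s)^T)))%:M.
have F1 : F 1 = F 0.
  apply: mx_derive0_cst => //.
    apply: mx_continuous_trace; apply: mx_continuous_mul;
      first exact: mx_continuous_cst.
    apply: mx_continuous_mul; last exact: mx_continuous_tr moving_continuous.
    by apply: mx_continuous_mul moving_continuous _; exact: mx_continuous_cst.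
  move=> s hs; have dm := moving_derive hs.
  have hs' : 0 <= s <= 1 by case/andP: hs => /ltW -> /ltW ->.
  have := mx_derive_trace (mx_derive_mul (mx_derive_cst symp_proj s)
   (mx_derive_mul (mx_derive_mul dm (mx_derive_cst shift_mx s))
     (mx_derive_tr dm))).
  (* The two quadratic equations, known at every s by now, supply the block shape without which the
     trace need not be constant. *)
  have [V21 V22] := PO32_blocks (h1 s hs') (s1 s hs').
  have := po32_trace (connection_along_po32 hs') V21 V22.
  set A := connection_along s => e.
  set V := moving s in V21 V22 e *.
  rewrite mulmx0 addr0 mul0mx add0r.
  have -> : (- A *m V)^T = - (V^T *m A^T) by rewrite mulNmx linearN /= trmx_mul.
  suff -> : \tr (symp_proj *m (- A *m V *m shift_mx *m V^T +
     V *m shift_mx *m - (V^T *m A^T))) = 0 by rewrite raddf0.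
  rewrite mulmxDr mxtraceD !mulNmx !mulmxN !raddfN /= -opprD.
  apply/eqP; rewrite oppr_eq0 -[X in _ == X]e; apply/eqP.
  rewrite mulmxDl mxtraceD; congr (_ + _); first by rewrite !mulmxA.
  by rewrite !mulmxA [LHS]mxtrace_mulC !mulmxA.
by have := congr1 (fun m : 'M[R]_1 => m 0 0) F1; rewrite /F !mxE !mulr1n t0.
Qed.

End Transport.

(** For the induction over the pieces of the path the endpoint is arbitrary, with coframe at q and
    frame at p. Each step takes the transport so far, applied to the frame at p, as the constant
    factor [Y]. *)
Lemma transport_PO32 (R : realType) (U : set 'rV[R]_2) (f : 'rV[R]_2 -> R)
    (M : set 'rV[R]_8) (p q : 'rV[R]_8) (A : 'M[R]_8) :
  open U -> smooth_on U f -> (forall z, U z -> f_3 f z != 0) ->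
  M `<=` ambient_domain U -> M p ->
  transport M (ambient_metric f) p q A ->
  M q /\ PO32 (coframe f q *m A *m frame f p).
Proof.
move=> oU sf f3 MU Mp; elim=> {q A}.
  split=> //; rewrite mulmx1 (coframeK f3 (MU _ Mp)); split.
  - by rewrite trmx1 mul1mx mulmx1.
  - by rewrite trmx1 mul1mx mulmx1.
  - rewrite trmx1 mulmx1 mul1mx /symp_proj /shift_mx mulmx_block.
    by rewrite !(mulmx0, mul0mx, addr0) block_mx0 mxtrace0.
move=> q r A c W _ [Mq IH] sc cM c0 c1 parW.
have in1 : 0 <= (1 : R) <= 1 by rewrite ler01 lexx.
split; first by rewrite -c1; exact: cM.
have cdom s : 0 <= s <= 1 -> ambient_domain U (c s) by move=> /cM /MU.
have := @moving_PO32 _ _ _ oU sf f3 _ _ sc cdom parW (A *m frame f p).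
rewrite /moving c0 c1; case: (parW) => -> _ _.
by rewrite mulmx1 !mulmxA => /(_ IH).
Qed.

(** * po(3,2) inside spin(4,3) *)

Section Spin43.
Context {R : realType}.

Lemma spin43D (A B : 'M[R]_8) : spin43 A -> spin43 B -> spin43 (A + B).
Proof.
move=> [m [a [b [s [x [ss sx ->]]]]]] [n [c [d [t [y [st sy ->]]]]]].
pose glue T (F : 'I_m -> T) (G : 'I_n -> T) (i : 'I_(m + n)) :=
  match fintype.split i with inl j => F j | inr j => G j end.
have gl T (F : 'I_m -> T) (G : 'I_n -> T) i : glue T F G (lshift n i) = F i.
  by rewrite /glue -[lshift n i]/(unsplit (inl i)) unsplitK.
have gr T (F : 'I_m -> T) (G : 'I_n -> T) i : glue T F G (rshift m i) = G i.
  by rewrite /glue -[rshift m i]/(unsplit (inr i)) unsplitK.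
exists (m + n)%N, (glue _ a c), (glue _ b d), (glue _ s t), (glue _ x y); split.
- by move=> i; rewrite /glue; case: fintype.split.
- by move=> i; rewrite /glue; case: fintype.split.
- rewrite big_split_ord /=; congr (_ + _); apply: eq_bigr => i _.
    by rewrite !gl.
  by rewrite !gr.
Qed.

Lemma spin43_commutator (a b : R) (s x : 'M[R]_4) : Defs.skew s -> Defs.skew x ->
  spin43 (clifford a s *m clifford b x - clifford b x *m clifford a s).
Proof.
move=> ss sx; exists 1%N, (fun=> a), (fun=> b), (fun=> s), (fun=> x).
by split=> //; rewrite big_ord1.
Qed.

(** The commutator with the vector (1/2, 0), which anticommutes with (0, s); the factor 1/2
    compensates the doubling. *)
Lemma spin43_bivector (s : 'M[R]_4) : Defs.skew s ->
  spin43 (block_mx 0 s (- hodge s) 0 : 'M[R]_(4 + 4)).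
Proof.
move=> ss; have s0 : Defs.skew (0 : 'M[R]_4) by rewrite /Defs.skew trmx0 oppr0.
have := spin43_commutator (2^-1) 0 s0 ss.
have h0 : hodge (0 : 'M[R]_4) = 0.
  by apply/matrixP => i j; rewrite !mxE /wedge_form !mxE; ring.
rewrite /clifford h0 !mulmx_block.
rewrite !(mulmx0, mul0mx, addr0, add0r) raddf0 oppr0
  !(mulmx0, mul0mx, addr0, add0r).
rewrite opp_block_mx add_block_mx !oppr0 !addr0 mul_scalar_mx mul_mx_scalar.
have hx (y : 'M[R]_4) : 2^-1 *: y + 2^-1 *: y = y.
  by rewrite -scalerDl -[X in X *: _](_ : 1 = _) ?scale1r//; field.
rewrite mulmxN opprK mul_mx_scalar hx mulNmx mul_scalar_mx -opprD hx.
by [].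
Qed.

Lemma ord4 (i : 'I_4) : [\/ i = 0, i = 1, i = 2 | i = 3].
Proof.
by case: i => -[|[|[|[|//]]]] ilt; [constructor 1|constructor 2|constructor 3|
  constructor 4]; exact: val_inj.
Qed.

Definition mx4 (l : seq R) : 'M[R]_4 := \matrix_(i, j) nth 0 l (4 * i + j).
Definition bv (x01 x02 x03 x12 x13 x23 : R) : 'M[R]_4 :=
  mx4 [:: 0; x01; x02; x03; - x01; 0; x12; x13;
          - x02; - x12; 0; x23; - x03; - x13; - x23; 0].

Lemma bv_skew a b c d e g : Defs.skew (bv a b c d e g).
Proof.
apply/matrixP => i j; rewrite !mxE.
by case: i => -[|[|[|[|//]]]] ?; case: j => -[|[|[|[|//]]]] ? /=;
  rewrite ?oppr0 ?opprK.
Qed.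

Lemma hodge_bv a b c d e g : hodge (bv a b c d e g) = bv g (- e) d c (- b) a.
Proof.
apply/matrixP => i j; rewrite !mxE /wedge_form !mxE.
by case: i => -[|[|[|[|//]]]] ?; case: j => -[|[|[|[|//]]]] ? /=; ring.
Qed.

(** Commutators of bivectors span so(3,3), which is sl_4 acting on R^4 + R^4*. *)
Lemma spin43_sl4 (X : 'M[R]_4) : \tr X = 0 ->
  spin43 (block_mx X 0 0 (- X^T) : 'M[R]_(4 + 4)).
Proof.
move=> trX.
have com (s x : 'M[R]_4) : Defs.skew s -> Defs.skew x ->
    spin43 (block_mx (s *m hodge x - x *m hodge s) 0 0
              (- (s *m hodge x - x *m hodge s)^T) : 'M[R]_(4 + 4)).
  move=> ss sx; have := spin43_commutator 0 0 ss sx.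
  rewrite /clifford !mulmx_block raddf0 oppr0.
  rewrite !(mulmx0, mul0mx, addr0, add0r) opp_block_mx add_block_mx !oppr0 !addr0.
  rewrite linearB /= !trmx_mul ss sx !hodge_skew !(mulmxN, mulNmx) !opprK opprB.
  by [].
have blockD (Y Z : 'M[R]_4) : block_mx Y 0 0 (- Y^T) + block_mx Z 0 0 (- Z^T) =
    block_mx (Y + Z) 0 0 (- (Y + Z)^T) :> 'M[R]_(4 + 4).
  by rewrite add_block_mx !addr0 linearD opprD.
pose h : R := 2^-1.
pose x03 := bv 0 0 1 0 0 0; pose x02 := bv 0 1 0 0 0 0.
pose x13 := bv 0 0 0 0 1 0; pose x12 := bv 0 0 0 1 0 0.
pose x23 := bv 0 0 0 0 0 1.
(* The 15 pairs of basis bivectors give a basis of so(3,3). In the order 01, 02, 03, 12, 13, 23 each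
   basis bivector is paired with a combination of its predecessors, whose coefficients solve a
   linear system. *)
pose s03 := bv (h * X 0 2) (- h * X 0 1) 0 0 0 0.
pose s02 := bv (- h * X 0 3) 0 0 0 0 0.
pose s13 := bv (h * X 1 2) (h * (X 0 0 + X 2 2)) (h * X 3 2) (h * X 1 0) 0 0.
pose s12 := bv (- h * X 1 3) (- h * X 2 3) (- h * (X 0 0 + X 3 3)) 0 0 0.
pose s23 := bv (- h * (X 0 0 + X 1 1)) (- h * X 2 1) (- h * X 3 1) (h * X 2 0)
  (h * X 3 0) 0.
pose c s x : 'M[R]_4 := s *m hodge x - x *m hodge s.
have -> : X = c s03 x03 + c s02 x02 + c s13 x13 + c s12 x12 + c s23 x23.
  rewrite /c /s03 /s02 /s13 /s12 /s23 /x03 /x02 /x13 /x12 /x23 !hodge_bv.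
  have X33 : X 3 3 = - (X 0 0 + X 1 1 + X 2 2).
    have e : \tr X = X 0 0 + X 1 1 + X 2 2 + X 3 3.
      rewrite /mxtrace !big_ord_recl big_ord0 addr0 !addrA.
      by congr (_ + _ + _ + _)%R; congr (X _ _); exact: val_inj.
    by apply/eqP; rewrite -addr_eq0 addrC -e trX.
  apply/matrixP => i j; rewrite !mxE !big_ord_recl !big_ord0 !mxE.
  by case: (ord4 i) => ->; case: (ord4 j) => -> /=; rewrite ?X33 /h; field.
have add (Y Z : 'M[R]_4) : spin43 (block_mx Y 0 0 (- Y^T) : 'M[R]_(4 + 4)) ->
    spin43 (block_mx Z 0 0 (- Z^T) : 'M[R]_(4 + 4)) ->
    spin43 (block_mx (Y + Z) 0 0 (- (Y + Z)^T) : 'M[R]_(4 + 4)).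
  by rewrite -blockD; exact: spin43D.
have cs s x (ss : Defs.skew s) (sx : Defs.skew x) :
  spin43 (block_mx (c s x) 0 0 (- (c s x)^T) : 'M[R]_(4 + 4)) := com s x ss sx.
have sk := bv_skew.
have S03 : spin43 _ := cs s03 x03 (sk _ _ _ _ _ _) (sk _ _ _ _ _ _).
have S02 : spin43 _ := cs s02 x02 (sk _ _ _ _ _ _) (sk _ _ _ _ _ _).
have S13 : spin43 _ := cs s13 x13 (sk _ _ _ _ _ _) (sk _ _ _ _ _ _).
have S12 : spin43 _ := cs s12 x12 (sk _ _ _ _ _ _) (sk _ _ _ _ _ _).
have S23 : spin43 _ := cs s23 x23 (sk _ _ _ _ _ _) (sk _ _ _ _ _ _).
exact: add (add _ _ (add _ _ (add _ _ S03 S02) S13) S12) S23.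
Qed.

End Spin43.

(* [swap_mx] exchanges e_1, e_4 with f_1, f_4 in R^8 = R^4 + R^4*. *)
Section Swap.
Context {R : realType}.
Definition midP : 'M[R]_4 := \matrix_(i, j) ((i == j) && (0 < i < 3)%N)%:R.
Definition outQ : 'M[R]_4 := \matrix_(i, j) ((i == j) && ~~ (0 < i < 3)%N)%:R.
Definition swap_mx : 'M[R]_(4 + 4) := block_mx midP outQ outQ midP.

Lemma midE (A : 'M[R]_4) : midP *m A =
  \matrix_(i, j) (if (0 < i < 3)%N then A i j else 0).
Proof.
apply/matrixP => i j; rewrite !mxE !big_ord_recl big_ord0 !mxE.
case: (ord4 i) => -> /=; rewrite ?mul0r ?mul1r ?add0r ?addr0//; congr (A _ _);
  exact: val_inj.
Qed.
Lemma outE (A : 'M[R]_4) : outQ *m A =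
  \matrix_(i, j) (if (0 < i < 3)%N then 0 else A i j).
Proof.
apply/matrixP => i j; rewrite !mxE !big_ord_recl big_ord0 !mxE.
case: (ord4 i) => -> /=; rewrite ?mul0r ?mul1r ?add0r ?addr0//; congr (A _ _);
  exact: val_inj.
Qed.
Lemma Emid (A : 'M[R]_4) : A *m midP =
  \matrix_(i, j) (if (0 < j < 3)%N then A i j else 0).
Proof.
apply/matrixP => i j; rewrite !mxE !big_ord_recl big_ord0 !mxE.
case: (ord4 j) => -> /=; rewrite ?mulr0 ?mulr1 ?add0r ?addr0//; congr (A _ _);
  exact: val_inj.
Qed.
Lemma Eout (A : 'M[R]_4) : A *m outQ =
  \matrix_(i, j) (if (0 < j < 3)%N then 0 else A i j).
Proof.
apply/matrixP => i j; rewrite !mxE !big_ord_recl big_ord0 !mxE.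
case: (ord4 j) => -> /=; rewrite ?mulr0 ?mulr1 ?add0r ?addr0//; congr (A _ _);
  exact: val_inj.
Qed.

Lemma swap_mxK : swap_mx *m swap_mx = 1%:M.
Proof.
rewrite /swap_mx mulmx_block (scalar_mx_block 4 4 1).
by congr block_mx; apply/matrixP => i j; rewrite ?(midE, outE) !mxE;
  case: (ord4 i) => ->; case: (ord4 j) => -> /=; rewrite ?addr0 ?add0r.
Qed.

Lemma swap_mx_form44 : swap_mx^T *m form44 *m swap_mx = form44.
Proof.
have tm : midP^T = midP.
  by apply/matrixP => i j; rewrite !mxE; case: (ord4 i) => ->;
    case: (ord4 j) => ->.
have tq : outQ^T = outQ.
  by apply/matrixP => i j; rewrite !mxE; case: (ord4 i) => ->;
    case: (ord4 j) => ->.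
rewrite /swap_mx /form44 tr_block_mx tm tq !mulmx_block.
rewrite !(mulmx0, mul0mx, mulmx1, addr0, add0r).
by congr block_mx; apply/matrixP => i j; rewrite ?(midE, outE) !mxE;
  case: (ord4 i) => ->; case: (ord4 j) => -> /=; rewrite ?addr0 ?add0r.
Qed.

(** After the swap the element has the form diag(Y, - Y^T) + [[0, s], [- hodge s, 0]] with Y of
    trace 0 and s skew. *)
Lemma po32_spin43 (A : 'M[R]_(4 + 4)) : po32 A ->
  spin43 (swap_mx *m A *m swap_mx).
Proof.
move=> [X [Z [-> trX skZ XJ wZ]]].
have hz i j : Z i j = - Z j i.
  by have := congr1 (fun m : 'M[R]_4 => m j i) skZ; rewrite !mxE.
have z0 i : Z i i = 0.
  by apply/eqP; have /eqP := hz i i; rewrite -subr_eq0 opprK -mulr2n mulrn_eq0.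
have hx i j := congr1 (fun m : 'M[R]_4 => m i j) XJ.
have [h01 h02 h03] := And3 (hx 0 1) (hx 0 2) (hx 0 3).
have [h12 h13 h23] := And3 (hx 1 2) (hx 1 3) (hx 2 3).
have e3 : lift ord0 (lift ord0 (lift ord0 ord0)) = 3 :> 'I_4 by exact: val_inj.
have e2 : lift ord0 (lift ord0 ord0) = 2 :> 'I_4 by exact: val_inj.
have e1 : lift ord0 ord0 = 1 :> 'I_4 by exact: val_inj.
have e0 : ord0 = 0 :> 'I_4 by exact: val_inj.
move: h01 h02 h03 h12 h13 h23 {hx XJ}.
rewrite !mxE !big_ord_recl !big_ord0 e3 e2 e1 e0 !mxE /=.
rewrite !(mulr0, mul0r, mulr1, mul1r, mulrN1, mulN1r, addr0, add0r).
move=> h1 h2 h3 h4 h5 h6.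
(* The symplectic condition entry by entry; [z12] is the orthogonality of Z to J. *)
have r13 : X 1 3 = X 0 2 by lra.
have r23 : X 2 3 = - X 0 1 by lra.
have r33 : X 3 3 = - X 0 0 by lra.
have r22 : X 2 2 = - X 1 1 by lra.
have r32 : X 3 2 = - X 1 0 by lra.
have r31 : X 3 1 = X 2 0 by lra.
have z12 : Z 1 2 = - Z 0 3.
  by move: wZ; rewrite /wedge_form !mxE /=; lra.
(* [Y] and [s] are the upper left and upper right blocks of the conjugated matrix. *)
pose Y := midP *m X *m midP + midP *m Z *m outQ - outQ *m X^T *m outQ.
pose s := midP *m X *m outQ + midP *m Z *m midP - outQ *m X^T *m midP.
have trY : \tr Y = 0.
  rewrite /Y !(midE, outE, Emid, Eout) /mxtrace !big_ord_recl big_ord0 e3 e2 e1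
    e0 !mxE /=.
  by rewrite r33 r22; ring.
have sks : Defs.skew s.
  rewrite /s /Defs.skew !(midE, outE, Emid, Eout); apply/matrixP => i j;
    rewrite !mxE.
  by case: (ord4 i) => ->; case: (ord4 j) => -> /=; rewrite ?z0 ?(hz 2 1); ring.
have -> : swap_mx *m po33_mx X Z *m swap_mx =
    block_mx Y 0 0 (- Y^T) + block_mx 0 s (- hodge s) 0.
  rewrite /swap_mx /po33_mx !mulmx_block !(mulmx0, add0r, addr0) add_block_mx.
  rewrite !addr0 !add0r; congr block_mx.
  - rewrite /Y !(midE, outE, Emid, Eout); apply/matrixP => i j; rewrite !mxE.
    by case: (ord4 i) => ->; case: (ord4 j) => -> /=; ring.
  - rewrite /s !(midE, outE, Emid, Eout); apply/matrixP => i j; rewrite !mxE.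
    by case: (ord4 i) => ->; case: (ord4 j) => -> /=; ring.
  (* The block where membership in po(3,2), and not just in po(3,3), is decisive: it ties the lower
     left block to the Hodge dual of [s]. *)
  - rewrite /s !(midE, outE, Emid, Eout); apply/matrixP => i j.
    rewrite !mxE /wedge_form !mxE /=.
    case: (ord4 i) => ->; case: (ord4 j) => -> /=;
      rewrite ?z0 ?(hz 1 0) ?(hz 2 0) ?(hz 3 0) ?(hz 2 1) ?(hz 3 1) ?(hz 3 2);
      rewrite ?z12 ?r13 ?r23 ?r33 ?r22 ?r32 ?r31; by field.
  - rewrite /Y !(midE, outE, Emid, Eout); apply/matrixP => i j; rewrite !mxE.
    case: (ord4 i) => ->; case: (ord4 j) => -> /=;
      rewrite ?z0 ?(hz 1 0) ?(hz 2 0) ?(hz 3 0) ?(hz 2 1) ?(hz 3 1) ?(hz 3 2);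
        by ring.
by apply: spin43D; [exact: spin43_sl4|exact: spin43_bivector].
Qed.
End Swap.

(** * The holonomy algebra *)

Section LieAlgebra.
Context {R : realType}.

Lemma mx_derive_const m n (F : R -> 'M[R]_(m, n)) s dF :
  (forall t, F t = F s) -> mx_derive F s dF -> dF = 0.
Proof.
move=> Fc dFs; apply: (mx_derive_unique dFs).
by rewrite (_ : F = fun=> F s); [exact: mx_derive_cst|apply/funext].
Qed.

(** The equations of [PO32] linearised at the identity. The degenerate form gives J Y = 0 for the
    lower left block Y, and the last equation becomes the vanishing of the trace of J Z. *)
Lemma tangent_po32 (B : 'M[R]_(4 + 4)) :
  B^T *m form44 + form44 *m B = 0 -> B^T *m symp_form + symp_form *m B = 0 ->
  \tr (symp_proj *m (B *m shift_mx + shift_mx *m B^T)) = 0 -> po32 B.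
Proof.
move: (ulsubmx B) (ursubmx B) (dlsubmx B) (drsubmx B) (submxK B) => X Z Y W <-.
rewrite /form44 /symp_form /symp_proj /shift_mx !tr_block_mx !mulmx_block.
rewrite !(mulmx0, mul0mx, mulmx1, mul1mx, add0r, addr0).
rewrite !add_block_mx -block_mx0 => /eq_block_mx[_ h12 _ h22].
move=> /eq_block_mx[_ _ g21 g22].
rewrite mulmx_block !(mulmx0, mul0mx, add0r, addr0) mxtrace_block mxtrace0 addr0.
move=> trZ.
have Y0 : Y = 0.
  have : J4 *m (J4 *m Y) = 0 by move: g21; rewrite add0r => ->; rewrite mulmx0.
  by rewrite mulmxA J4_sqr mulNmx mul1mx => /eqP; rewrite oppr_eq0 => /eqP.
have WE : W = - X^T by apply/eqP; rewrite -addr_eq0 addrC h12.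
have sZ : Defs.skew Z by apply/eqP; rewrite -addr_eq0 h22.
have XJ : X *m J4 + J4 *m X^T = 0.
  move: g22; rewrite WE linearN /= trmxK mulNmx mulmxN -opprD => /eqP.
  by rewrite oppr_eq0 => /eqP.
exists X, Z; split=> //.
- by rewrite /po33_mx Y0 WE.
- exact: sp_trace.
- exact/wedge_form_J4.
Qed.

Lemma idempotent_unit n (A B : 'M[R]_n) : A *m A = A -> B *m A = 1%:M -> A = 1%:M.
Proof. by move=> AA BA; rewrite -[A]mul1mx -{1}BA -mulmxA AA. Qed.

Lemma PO32_one_param (V : R -> 'M[R]_(4 + 4)) B : (forall s, PO32 (V s)) ->
  V 0 = 1%:M -> mx_derive V 0 B -> po32 B.
Proof.
move=> VG V0 dV; apply: tangent_po32.
- have := mx_derive_mul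
    (mx_derive_mul (mx_derive_tr dV) (mx_derive_cst form44 0)) dV.
  rewrite V0 trmx1 !mulmx0 addr0 mulmx1 mul1mx; apply: mx_derive_const => t.
  by case: (VG t) => -> _ _; case: (VG 0) => -> _ _.
- have := mx_derive_mul
    (mx_derive_mul (mx_derive_tr dV) (mx_derive_cst symp_form 0)) dV.
  rewrite V0 trmx1 !mulmx0 addr0 mulmx1 mul1mx; apply: mx_derive_const => t.
  by case: (VG t) => _ -> _; case: (VG 0) => _ -> _.
- have := mx_derive_trace (mx_derive_mul (mx_derive_cst symp_proj 0)
   (mx_derive_mul (mx_derive_mul dV (mx_derive_cst shift_mx 0))
     (mx_derive_tr dV))).
  rewrite V0 trmx1 !mulmx0 mul0mx addr0 add0r mulmx1 mul1mx.
  move=> /mx_derive_const d0.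
  have := d0 _; move=> /(_ _)/(congr1 (fun m : 'M[R]_1 => m 0 0)).
  rewrite !mxE mulr1n; apply=> t.
  by case: (VG t) => _ _ ->; case: (VG 0) => _ _ ->.
Qed.

End LieAlgebra.

(** Composing an adapted basis T with an isometry S of [form44] gives the adapted basis T S. *)
Lemma contained_up_to_conj_trans (R : realType) (g S : 'M[R]_8)
  (h a b : set 'M[R]_8) :
  S^T *m form44 *m S = form44 -> (forall A, a A -> b (invmx S *m A *m S)) ->
  contained_up_to_conj g h a -> contained_up_to_conj g h b.
Proof.
move=> Sh ab [T [Tg ha]]; exists (T *m S); split.
  by rewrite trmx_mul !mulmxA -(mulmxA S^T) -(mulmxA S^T) Tg.
move=> A /ha/ab; suff -> : invmx (T *m S) = invmx S *m invmx T by rewrite !mulmxA.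
have uS : S \in unitmx.
  have : form44 *m (S^T *m form44) *m S = 1%:M by rewrite -mulmxA Sh form44K.
  by case/mulmx1_unit.
have uT : T \in unitmx.
  have : form44 *m (T^T *m g) *m T = 1%:M by rewrite -mulmxA Tg form44K.
  by case/mulmx1_unit.
have uTS : T *m S \in unitmx by rewrite unitmx_mul uT.
rewrite -[LHS]mul1mx -(mulVmx uS) -[X in invmx S *m X]mul1mx -(mulVmx uT).
by rewrite !mulmxA -[X in X *m invmx _]mulmxA -[LHS]mulmxA -mulmxA mulmxV//
  mulmx1.
Qed.

Theorem theorem4p2 (R : realType) (U : set 'rV[R]_2) (f : 'rV[R]_2 -> R)
    (M : set 'rV[R]_8) (p : 'rV[R]_8) :
  open U -> smooth_on U f -> (forall z, U z -> f_3 f z != 0) ->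
  open M -> (forall u, M u -> 0 < coord_t u /\ U (x13 (base u))) ->
  M p ->
  contained_up_to_conj (ambient_metric f p)
    (holonomy_algebra M (ambient_metric f) p) po32
  /\ contained_up_to_conj (ambient_metric f p)
       (holonomy_algebra M (ambient_metric f) p) spin43.
Proof.
move=> oU sf f3 _ MU Mp.
have dp := MU _ Mp.
have ET := coframeK f3 dp; have TE := mulmx1C ET.
have main : contained_up_to_conj (ambient_metric f p)
    (holonomy_algebra M (ambient_metric f) p) po32.
  exists (frame f p); split; first exact: (frame_orthonormal oU sf f3 dp).
  have uT : frame f p \in unitmx by case: (mulmx1_unit ET).
  have -> : invmx (frame f p) = coframe f p.
    by rewrite -[RHS]mulmx1 -(mulmxV uT) mulmxA ET mul1mx.
  move=> A [phi [hphi phiD dphi]].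
  pose V s : 'M[R]_(4 + 4) := coframe f p *m phi s *m frame f p.
  have VG s : PO32 (V s).
    by have [] := @transport_PO32 _ _ _ _ _ _ _ oU sf f3 MU Mp (hphi s).
  apply: (@PO32_one_param _ V) => //.
    (* [phi 0 = 1] is not part of the definition: additivity makes [V 0] idempotent, and preserving
       [form44] makes it invertible. *)
    have VV : V 0 *m V 0 = V 0.
      have e : phi 0 *m phi 0 = phi 0 by rewrite -phiD addr0.
      transitivity (coframe f p *m phi 0 *m (frame f p *m coframe f p) *m phi 0
        *m frame f p); first by rewrite /V !mulmxA.
      by rewrite TE mulmx1 -(mulmxA (coframe f p)) e.
    have [Vh _ _] := VG 0.
    apply: (idempotent_unit VV (B := form44 *m ((V 0)^T *m form44))).
    by rewrite -mulmxA Vh form44K.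
  have := mx_derive_mul (mx_derive_mul (mx_derive_cst (coframe f p) 0) dphi)
    (mx_derive_cst (frame f p) 0).
  by rewrite mul0mx add0r mulmx0 addr0.
split=> //; apply: contained_up_to_conj_trans main; first exact: swap_mx_form44.
move=> A pA; have -> : invmx swap_mx = swap_mx :> 'M[R]_8.
  have uS : (swap_mx : 'M[R]_8) \in unitmx by case: (mulmx1_unit (@swap_mxK R)).
  by rewrite -[RHS]mulmx1 -(mulmxV uS) mulmxA swap_mxK mul1mx.
exact: po32_spin43.
Qed.
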